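(* Under the same setting and the Lipschitz kernel assumption, there are constants $c,C>0$ such that for all $N\ge1$ and all $\varepsilon>0$, $$P\left[\left|\int\mathcal{W}(\hat\pi^N_{x_1},\hat\pi^N_2)\,\hat\pi^N_1(dx_1)-\int\mathcal{W}(\pi_{x_1},\nu)\,\mu(dx_1)\right|\ge2C\,\mathrm{rate}(N)+\varepsilon\right]\le4\exp(-cN\varepsilon^2).$$
   Context: $\pi$ is a Borel probability measure on $[0,1]^d\times[0,1]^d$ with marginals $\mu,\nu$; $(X_1^n,X_2^n)_{n\ge1}$ i.i.d. with law $\pi$; $[0,1]^d$ carries the Euclidean metric; $\mathcal{W}$ is the $1$-Wasserstein distance. Lipschitz kernel assumption: some version of the disintegration $x_1\mapsto\pi_{x_1}$ is Lipschitz from $([0,1]^d,|\cdot|_2)$ to $(\mathrm{Prob}([0,1]^d),\mathcal{W})$. Grid: $r=1/3$ if $d=1$, $r=1/(2d)$ if $d\ge2$; $[0,1]^d$ is partitioned into $N^{rd}$ cubes of edge length $N^{-r}$ and $\varphi^N$ maps each cube to its center; $\hat\pi^N=\frac1N\sum_{n=1}^N\delta_{(\varphi^N(X_1^n),\varphi^N(X_2^n))}$ with marginals $\hat\pi^N_1,\hat\pi^N_2$ and disintegration $\hat\pi^N_{x_1}$. $\mathrm{rate}(N)=N^{-1/3}$ for $d=1$, $N^{-1/4}\log(N+1)$ for $d=2$, $N^{-1/(2d)}$ for $d\ge3$.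
   Formalization: Since N^r need not be an integer, the grid uses floor(N^r) cells per axis, i.e. floor(N^r)^d cubes of edge length 1/floor(N^r), in place of N^{rd} cubes of edge N^{-r}; the two agree when N^r is an integer. *)

(* Defs.v *)
From mathcomp Require Import all_boot all_order all_algebra.
From mathcomp Require Import all_classical all_reals all_analysis.
Set Implicit Arguments.
Unset Strict Implicit.
Unset Printing Implicit Defensive.
Import Order.TTheory GRing.Theory Num.Theory numFieldNormedType.Exports.
Local Open Scope classical_set_scope.
Local Open Scope ring_scope.

Notation Rd R d := (g_sigma_algebraType (@open 'rV[R]_d)).

Lemma invn_ge0 (R : realType) (n : nat) : (0 : R) <= n%:R^-1.
Proof. by rewrite invr_ge0. Qed.

Section Defs.
Context {R : realType} {d : nat}.
Local Notation T := (Rd R d).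

Definition eucl (x y : 'rV[R]_d) : R :=
  Num.sqrt (\sum_(i < d) (x ord0 i - y ord0 i) ^+ 2).

Definition cube : set T := [set x | forall i : 'I_d, 0 <= x ord0 i <= 1].

Definition coupling (mu nu : set T -> \bar R) (g : probability (T * T)%type R) :=
  (forall A : set T, measurable A -> g (A `*` setT) = mu A) /\
  (forall B : set T, measurable B -> g (setT `*` B) = nu B).

Definition W1 (mu nu : set T -> \bar R) : \bar R :=
  ereal_inf [set (\int[g]_z (eucl z.1 z.2)%:E)%E
            | g in [set g | coupling mu nu g]].

Definition disintegration (pi : probability (T * T)%type R)
    (mu : probability T R) (k : R.-pker T ~> T) :=
  forall A B : set T, measurable A -> measurable B ->
    pi (A `*` B) = (\int[mu]_(x in A) k x B)%E.

Definition lipschitz_kernel (k : R.-pker T ~> T) :=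
  exists L : R, forall x y : T, cube x -> cube y ->
    (W1 (k x) (k y) <= (L * eucl x y)%:E)%E.

Definition grid_r : R := if d == 1%N then 3^-1 else (2 * d%:R)^-1.

Definition rate (N : nat) : R :=
  if d == 1%N then N%:R `^ (- 3^-1)
  else if d == 2%N then N%:R `^ (- 4^-1) * ln (N.+1%:R)
  else N%:R `^ (- (2 * d%:R)^-1).

(* number of grid cells per axis: N^r (rounded down, at least 1 for N >= 1) *)
Definition cells (N : nat) : nat := Num.truncn (N%:R `^ grid_r).

(* one-dimensional cell-center map for M cells of length 1/M on [0,1]:
   cells [j/M,(j+1)/M) for j < M-1, last cell closed *)
Definition center1 (M : nat) (t : R) : R :=
  let j : int := Order.max 0%R (Order.min (Num.floor (t * M%:R)) (M%:Z - 1)) in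
  (j%:~R + 2^-1) / M%:R.

Definition phiN (N : nat) (x : T) : T :=
  \row_(i < d) center1 (cells N) (x ord0 i).

Definition empirical (N : nat) (p : nat -> T) : {measure set T -> \bar R} :=
  mscale (NngNum (invn_ge0 R N))
         (msum (fun n => (\d_(p n) : {measure set T -> \bar R})) N).

Definition emp_cond (N : nat) (p1 p2 : nat -> T) (x : T)
  : {measure set T -> \bar R} :=
  mscale (NngNum (invn_ge0 R (\sum_(n < N) ((p1 n : 'rV[R]_d) == x))))
    (msum (fun n => if (p1 n : 'rV[R]_d) == x
                    then (\d_(p2 n) : {measure set T -> \bar R})
                    else mzero) N).

End Defs.

Definition iid_law {R : realType} {dO dT : measure_display}
    {Omega : measurableType dO} {TT : measurableType dT}
    (P : probability Omega R) (X : nat -> Omega -> TT)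
    (pi : probability TT R) :=
  (forall n, measurable_fun setT (X n)) /\
  (forall n (A : set TT), measurable A -> P (X n @^-1` A) = pi A) /\
  (forall (I : seq nat) (A : nat -> set TT), uniq I ->
     (forall n, measurable (A n)) ->
     P (\bigcap_(n in [set n | n \in I]) (X n @^-1` A n)) =
     (\prod_(n <- I) P (X n @^-1` A n))%E).

(* Main.v *)
Require Import Defs.
From mathcomp Require Import all_boot all_order all_algebra.
From mathcomp Require Import all_classical all_reals all_analysis.
From mathcomp Require Import measurable_realfun zify ring lra.
Set Implicit Arguments.
Unset Strict Implicit.
Unset Printing Implicit Defensive.
Import Order.TTheory GRing.Theory Num.Theory numFieldNormedType.Exports.
Local Open Scope classical_set_scope.
Local Open Scope ring_scope.

(** By Kantorovich duality the [W1] cost between measures on the grid is the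
    seminorm [kr] applied to their difference, and [kr] is homogeneous.  Hence,
    up to an error of the order of the mesh, both sides of the inequality are
    values of one functional of a joint law [Q] on pairs of cells,
    [dependence Q = sum_s kr (Q(s, .) - Q_1(s) Q_2)], at the empirical law and
    at [pi]; for [pi] this uses that the Lipschitz kernel makes [W1 (k x) nu]
    almost constant on each cell.  Changing one sample moves the functional by [O(1/N)], so McDiarmid's
    inequality gives the Gaussian tail around the mean.  The mean deviation is
    bounded by chaining along dyadic coarsenings of the grid, each scale
    contributing (diameter) * sqrt (number of cell pairs / N).  Since the
    discretized samples take finitely many values, all the probability is done
    with finite sums; in particular the event is measurable. *)

(** * Finite Kantorovich duality *)

(** Empirical conditional laws have random denominators. Multiplying by the row mass removes them:
    for a row of positive mass, [kr] of the row minus the product row is the mass times the cost. So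
    [dependence] contains no division, and rows of mass zero contribute nothing.

    Comparing two joint laws involves row differences of nonzero total mass, for which Lipschitz
    test functions alone would give an infinite supremum. Potentials are therefore also bounded by
    [B], at least the diameter of the centers; between probability vectors this costs nothing, since
    a potential may be shifted by a constant.

    Only the second coordinate is coarsened, because [dependence] keeps the rows separate. With M
    cells per axis, scale l has about M^d (M/2^l)^d cell pairs and contributes 2^l/M times the
    square root of this number over N. The sum is dominated by the coarsest scale for d = 1 and by
    the finest for d >= 3; for d = 2 all scales weigh the same, whence the logarithm. *)

Section Sublinear.
Context {R : realType} {V : lmodType R}.
Implicit Types (p : V -> R) (u v w : V).

(** Homogeneity is asked only as an inequality for a > 0, which is what infima deliver. Equality for
    a >= 0 follows by applying it to the inverse of a as well ([sublinearZ]). *)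
Definition sublinear p :=
  (forall v w, p (v + w) <= p v + p w) /\
  (forall a v, 0 < a -> p (a *: v) <= a * p v).

Lemma sublinear0 p : sublinear p -> p 0 = 0.
Proof.
move=> [pD pZ]; have := pD 0 0; rewrite addr0 => h0.
have := pZ (2^-1) 0; rewrite scaler0 => /(_ _) h1.
have : 0 < 2^-1 :> R by rewrite invr_gt0.
by move=> /h1; lra.
Qed.

Lemma sublinearN p v : sublinear p -> - p v <= p (- v).
Proof.
move=> sp; have := sp.1 v (- v); rewrite subrr sublinear0//; lra.
Qed.

(** For sublinear [p] the reverse inequality always holds ([sublinearN]), so this says that [p] is
    linear along the line of [v]. Such [v] form a subspace. *)
Definition linear_at p v := p (- v) <= - p v.

Lemma linear_atD p v w :
  sublinear p -> linear_at p v -> linear_at p w -> linear_at p (v + w).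
Proof.
move=> [pD _]; rewrite /linear_at opprD => hv hw.
have := pD (- v) (- w); have := pD v w; lra.
Qed.

Lemma linear_atN p v : linear_at p v -> linear_at p (- v).
Proof. by rewrite /linear_at opprK lerNr. Qed.

Lemma sublinearZ p a v : sublinear p -> 0 <= a -> p (a *: v) = a * p v.
Proof.
move=> sp; rewrite le_eqVlt => /predU1P[<-|a0].
  by rewrite scale0r mul0r sublinear0.
apply/eqP; rewrite eq_le sp.2//=.
have := sp.2 a^-1 (a *: v); rewrite invr_gt0 => /(_ a0).
rewrite scalerA mulVf ?gt_eqF// scale1r => h.
by rewrite -ler_pdivlMl.
Qed.

Lemma linear_atZ p a v : sublinear p -> linear_at p v -> linear_at p (a *: v).
Proof.
move=> sp.
have pos b w : 0 <= b -> linear_at p w -> linear_at p (b *: w).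
  move=> b0; rewrite /linear_at -scalerN !sublinearZ// => h.
  by rewrite -mulrN ler_wpM2l.
have [a0|a0] := leP 0 a; first exact: pos.
move=> h; rewrite -[a]opprK -[- a]opprK scaleNr; apply: linear_atN.
by rewrite opprK; apply: pos => //; rewrite oppr_ge0 ltW.
Qed.

Lemma linear_atE p v w : sublinear p -> linear_at p w -> p (v + w) = p v + p w.
Proof.
move=> sp hw; apply/eqP; rewrite eq_le sp.1/=.
have := sp.1 (v + w) (- w); rewrite addrK; move: hw; rewrite /linear_at; lra.
Qed.

(* [p' w = inf_(t >= 0) p (w + t v) - t p v].  Iterating over a basis gives the
   Hahn-Banach theorem in finite dimension. *)
Lemma sublinear_step p v : sublinear p ->
  exists p', [/\ sublinear p', (forall w, p' w <= p w) & linear_at p' v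
    /\ p' (- v) <= - p v].
Proof.
move=> sp.
pose E w := [set p (w + t *: v) - t * p v | t in [set t | 0 <= t]].
(* Subadditivity at w + t v and - w: p (t v) = t p v is at most p (w + t v) + p (- w). *)
have lbE w : lbound (E w) (- p (- w)).
  move=> _ [t /= t0 <-].
  have := sp.1 (w + t *: v) (- w).
  by rewrite addrAC subrr add0r sublinearZ//; lra.
have E0 w : E w !=set0 by exists (p (w + 0 *: v) - 0 * p v), 0 => //=.
pose p' w := inf (E w).
have p'le w t : 0 <= t -> p' w <= p (w + t *: v) - t * p v.
  by move=> t0; apply: ge_inf; [exists (- p (- w)); exact: lbE|exists t].
have p'ge w x : (forall t, 0 <= t -> x <= p (w + t *: v) - t * p v) -> x <= p' w.
  by move=> h; apply: lb_le_inf => // _ [t /= t0 <-]; exact: h.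
have p'p w : p' w <= p w.
  by have := p'le w 0 (lexx _); rewrite scale0r addr0 mul0r subr0.
have sp' : sublinear p'.
  split=> [u w|a w a0].
    rewrite -lerBlDr; apply: (p'ge) => t t0.
    rewrite lerBlDr -lerBlDl; apply: (p'ge) => s s0.
    have := p'le (u + w) (t + s) (addr_ge0 t0 s0).
    have -> : u + w + (t + s) *: v = (u + t *: v) + (w + s *: v).
      by rewrite scalerDl addrACA.
    have := sp.1 (u + t *: v) (w + s *: v); lra.
  rewrite -ler_pdivrMl//; apply: (p'ge) => t t0; rewrite ler_pdivrMl//.
  have := p'le (a *: w) (a * t) (mulr_ge0 (ltW a0) t0).
  by rewrite -scalerA -scalerDr (sublinearZ _ sp) ?(ltW a0)// mulrBr mulrA.
have p'Nv : p' (- v) <= - p v.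
  have := p'le (- v) 1 ler01; rewrite scale1r addNr sublinear0//; lra.
exists p'; split => //; split => //.
by rewrite /linear_at (le_trans p'Nv)// lerN2.
Qed.

Lemma sublinear_linear (s : seq V) p : sublinear p ->
  exists p', [/\ sublinear p', (forall w, p' w <= p w) &
    forall v, v \in s -> linear_at p' v].
Proof.
elim: s p => [|v s ih] p sp; first by exists p.
have [p1 [sp1 p1p [p1v _]]] := sublinear_step v sp.
have [p2 [sp2 p2p p2s]] := ih _ sp1.
exists p2; split => // [w|w]; first exact: le_trans (p1p w).
rewrite inE => /predU1P[->|]; last exact: p2s.
(* Linearity at [v] survives any further decrease: p2 (-v) <= p1 (-v) <= - p1 v <= - p2 v. *)
by rewrite /linear_at (le_trans (p2p _))// (le_trans p1v)// lerN2.
Qed.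

(** Taking the first step in the direction [v] forces the value at - v down to - p v, and later
    steps only decrease it. Together with p' <= p this gives p' v = p v: a supporting functional at
    [v]. *)
Lemma sublinear_linear_attained (s : seq V) p v : sublinear p ->
  exists p', [/\ sublinear p', (forall w, p' w <= p w),
    (forall w, w \in s -> linear_at p' w) & p' (- v) <= - p v].
Proof.
move=> sp; have [p1 [sp1 p1p [_ p1v]]] := sublinear_step v sp.
have [p2 [sp2 p2p1 p2s]] := sublinear_linear s sp1.
by exists p2; split => // [w|]; [exact: le_trans (p1p w)|exact: le_trans p1v].
Qed.

End Sublinear.

Section FiniteDual.
Context {R : realType} {S : finType} (dist : S -> S -> R) (B : R).
Hypothesis dist_ge0 : forall s t, 0 <= dist s t.
Hypothesis B_ge0 : 0 <= B.
Implicit Types (u f g : S -> R).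

Definition potential u :=
  (forall s t, u s - u t <= dist s t) /\ (forall s, `|u s| <= B).

Definition kr f : R := sup [set \sum_s u s * f s | u in potential].

Lemma potential_le u f : potential u -> \sum_s u s * f s <= B * \sum_s `|f s|.
Proof.
move=> [_ uB]; rewrite mulr_sumr; apply: ler_sum => s _.
by rewrite (le_trans (ler_norm _))// normrM ler_wpM2r.
Qed.

Lemma le_kr u f : potential u -> \sum_s u s * f s <= kr f.
Proof.
move=> hu; apply: ub_le_sup; last by exists u.
by exists (B * \sum_s `|f s|) => _ [v hv <-]; exact: potential_le.
Qed.

Lemma potential0 : potential (fun=> 0).
Proof. by split=> *; rewrite ?subr0 ?normr0. Qed.

Lemma kr_le f (x : R) : (forall u, potential u -> \sum_s u s * f s <= x) ->
  kr f <= x.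
Proof.
move=> h; apply: ge_sup => [|_ [u hu <-]]; last exact: h.
by exists (\sum_s 0 * f s), (fun=> 0) => //; exact: potential0.
Qed.

Lemma kr_ge0 f : 0 <= kr f.
Proof.
apply: le_trans (le_kr f potential0).
by rewrite big1// => s _; rewrite mul0r.
Qed.

Lemma kr_norm1 f : kr f <= B * \sum_s `|f s|.
Proof. by apply: kr_le => u; exact: potential_le. Qed.

Lemma kr_add f g : kr (fun s => f s + g s) <= kr f + kr g.
Proof.
apply: kr_le => u hu.
have -> : \sum_s u s * (f s + g s) = \sum_s u s * f s + \sum_s u s * g s.
  by rewrite -big_split; apply: eq_bigr => s _; rewrite /= mulrDr.
by rewrite lerD ?le_kr.
Qed.

Lemma kr_sum (I : Type) (r : seq I) (P : pred I) (F : I -> S -> R) :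
  kr (fun s => \sum_(i <- r | P i) F i s) <= \sum_(i <- r | P i) kr (F i).
Proof.
apply: kr_le => u hu; under eq_bigr do rewrite mulr_sumr.
by rewrite exchange_big/=; apply: ler_sum => i _; exact: le_kr.
Qed.

Lemma krZ_le a f : 0 <= a -> kr (fun s => a * f s) <= a * kr f.
Proof.
move=> a0; apply: kr_le => u hu.
under eq_bigr do rewrite mulrCA.
by rewrite -mulr_sumr ler_wpM2l// le_kr.
Qed.

Lemma krZ a f : 0 <= a -> kr (fun s => a * f s) = a * kr f.
Proof.
move=> a0; apply/eqP; rewrite eq_le krZ_le//=.
move: a0; rewrite [X in is_true X -> _]le_eqVlt => /predU1P[<-|a0]; first by rewrite mul0r kr_ge0.
rewrite -ler_pdivlMl//.
apply: le_trans (krZ_le (fun s => a * f s) _); last by rewrite invr_ge0 ltW.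
rewrite le_eqVlt; apply/orP; left; apply/eqP; congr kr.
by apply/funext => s; rewrite mulrA mulVf ?mul1r// gt_eqF.
Qed.

Lemma krN f : (forall s t, dist s t = dist t s) -> kr (fun s => - f s) = kr f.
Proof.
move=> dC; suff le g : kr (fun s => - g s) <= kr g.
  apply/eqP; rewrite eq_le le/=.
  by rewrite -[leLHS](congr1 kr (_ : (fun s => - - f s) = f))// ?le//;
    apply/funext => s; rewrite opprK.
apply: kr_le => u [ul uB]; under eq_bigr do rewrite mulrN -mulNr.
apply: (le_kr (u := fun s => - u s)).
split=> [s t|s]; last by rewrite normrN.
by rewrite opprK addrC dC.
Qed.

Hypothesis distC : forall s t, dist s t = dist t s.

Lemma kr_ler_add f g : kr f <= kr g + kr (fun s => f s - g s).
Proof.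
rewrite -[leLHS](congr1 kr (_ : (fun s => g s + (f s - g s)) = f)) ?kr_add//.
by apply/funext => s; rewrite addrC subrK.
Qed.

Lemma kr_dist f g : `|kr f - kr g| <= kr (fun s => f s - g s).
Proof.
rewrite ler_norml lerBlDl kr_ler_add andbT lerBrDr addrC lerBlDr.
rewrite -(krN (fun s => f s - g s))//.
rewrite -[X in _ + X](congr1 kr (_ : (fun s => g s - f s) = _)) ?kr_ler_add//.
by apply/funext => s; rewrite opprB.
Qed.

Hypothesis dist_refl : forall s, dist s s = 0.
Hypothesis dist_tri : forall s t r, dist s r <= dist s t + dist t r.
Hypothesis dist_B : forall s t, dist s t <= B.

(* Any dual pair is dominated by the pair [(w, - w)] where
   [w s = min_t (dist s t - v t)] is its c-transform. *)
Lemma dual_pair_le (p q u v : S -> R) :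
  (forall s, 0 <= p s) -> (forall s, 0 <= q s) ->
  \sum_s p s = 1 -> \sum_s q s = 1 ->
  (forall s t, u s + v t <= dist s t) ->
  \sum_s p s * u s + \sum_s q s * v s <= kr (fun s => p s - q s).
Proof.
move=> p0 q0 p1 q1 uv.
have [s0 _] : exists s0 : S, true.
  have [//|S0] := pselect (exists s0 : S, true).
  exfalso; move: p1; rewrite big1 => [/esym/eqP|s]; first by rewrite oner_eq0.
  by exfalso; apply: S0; exists s.
pose w s := dist s [arg min_(t < s0) (dist s t - v t)]%O -
  v [arg min_(t < s0) (dist s t - v t)]%O.
have wle s t : w s <= dist s t - v t.
  by rewrite /w; case: arg_minP => // i _; exact.
have wge s x : (forall t, x <= dist s t - v t) -> x <= w s by rewrite /w.
have uw s : u s <= w s by apply: wge => t; rewrite lerBrDr.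
have vw s : v s <= - w s.
  by have := wle s s; rewrite dist_refl sub0r lerNr.
have wlip s t : w s - w t <= dist s t.
  rewrite lerBlDl -lerBlDr; apply: wge => r.
  have := wle s r; have := dist_tri s t r; lra.
(* Anchoring [w] at [s0] bounds it by the diameter, hence by [B]. The shift does not change the
   pairing, as [p] and [q] have the same mass. *)
pose w' s := w s - w s0.
have hw' : potential w'.
  split=> [s t|s]; first by have := wlip s t; rewrite /w'; lra.
  rewrite ler_norml; apply/andP; split.
    by rewrite lerNl opprB (le_trans (wlip _ _)).
  by rewrite (le_trans (wlip _ _)).
apply: le_trans (le_kr _ hw').
have -> : \sum_s w' s * (p s - q s) = \sum_s p s * w s + \sum_s q s * - w s.
  have : \sum_s w s0 * (p s - q s) = 0.
    by rewrite -mulr_sumr sumrB p1 q1 subrr mulr0.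
  move=> h; rewrite -[RHS]subr0 -[X in _ - X]h -big_split/= -sumrB; apply: eq_bigr => s _ /=.
  rewrite /w'; ring.
by rewrite lerD//; apply: ler_sum => s _; rewrite ler_wpM2l.
Qed.

(** The value [P h] of the dual problem for a reward h on pairs is sublinear in h. A linear
    functional below [P] is a coupling: it is nonnegative because P (- e st) <= 0, and evaluating it
    on u + v and on - (u + v) fixes its marginals. Choosing it to support [P] at minus the distance
    makes it optimal. *)
Theorem finite_kantorovich (p q : S -> R) :
  (forall s, 0 <= p s) -> (forall s, 0 <= q s) ->
  \sum_s p s = 1 -> \sum_s q s = 1 ->
  exists m : S -> S -> R, [/\ forall s t, 0 <= m s t,
    forall s, \sum_t m s t = p s, forall t, \sum_s m s t = q t &
    \sum_s \sum_t m s t * dist s t <= kr (fun s => p s - q s)].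
Proof.
move=> p0 q0 p1 q1.
pose V := {ffun S * S -> R^o}.
pose val (uv : (S -> R) * (S -> R)) := \sum_s p s * uv.1 s + \sum_s q s * uv.2 s.
pose adm (h : V) := [set uv : (S -> R) * (S -> R) | forall s t, h (s, t) <= uv.1 s + uv.2 t].
(* The product coupling of [p] and [q] bounds the dual values from below, so the infimum is
   finite. *)
have lbE (h : V) : lbound [set val uv | uv in adm h] (\sum_s \sum_t p s * q t * h (s, t)).
  move=> _ [[u v] /= huv <-]; rewrite /val/=.
  have -> : \sum_s p s * u s + \sum_s q s * v s =
      \sum_s \sum_t p s * q t * (u s + v t).
    rewrite -[X in _ + X]mul1r -p1 mulr_suml -big_split; apply: eq_bigr => s _ /=.
    rewrite mulr_sumr -[p s * u s]mul1r -{1}q1 mulr_suml -big_split.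
    by apply: eq_bigr => t _ /=; ring.
  apply: ler_sum => s _; apply: ler_sum => t _.
  by rewrite ler_wpM2l ?mulr_ge0.
pose P (h : V) := inf [set val uv | uv in adm h].
have Ple (h : V) (u v : S -> R) : (forall s t, h (s, t) <= u s + v t) -> P h <= val (u, v).
  by move=> huv; apply: ge_inf; [eexists; exact: lbE|exists (u, v)].
have Pge (h : V) x : (forall u v : S -> R,
    (forall s t, h (s, t) <= u s + v t) -> x <= val (u, v)) -> x <= P h.
  move=> hx; apply: lb_le_inf => [|_ [[u v] /= huv <-]]; last exact: hx.
  exists (val (fun=> \sum_st `|h st|, fun=> 0)), (fun=> \sum_st `|h st|, fun=> 0) => //.
  move=> s t /=; rewrite addr0 (le_trans (ler_norm _))//.
  by rewrite (bigD1 (s, t))//= lerDl sumr_ge0.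
have sP : sublinear P.
  split=> [h g|a h a0].
    rewrite -lerBlDr; apply: (Pge) => u v huv.
    rewrite lerBlDr -lerBlDl; apply: (Pge) => u' v' huv'.
    rewrite lerBlDl.
    apply: (@le_trans _ _ (val (fun s => u s + u' s, fun s => v s + v' s))).
      apply: Ple => s t; rewrite ffunE.
      by rewrite addrACA lerD.
    rewrite /val/=.
    under eq_bigr do rewrite mulrDr.
    under [X in _ + X]eq_bigr do rewrite mulrDr.
    by rewrite !big_split/= addrACA.
  rewrite -ler_pdivrMl//; apply: (Pge) => u v huv; rewrite ler_pdivrMl//.
  apply: (@le_trans _ _ (val (fun s => a * u s, fun s => a * v s))).
    by apply: Ple => s t; rewrite ffunE -mulrDr ler_wpM2l// ltW.
  rewrite /val/=.
  under eq_bigr do rewrite mulrCA.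
  under [X in _ + X]eq_bigr do rewrite mulrCA.
  by rewrite -!mulr_sumr mulrDr.
pose e st : V := [ffun x => (x == st)%:R].
(* With this sign the transport cost of the coupling is P' (- c) <= - P c, and - P c is the supremum
   over dual pairs below [dist]. *)
pose c : V := [ffun st => - dist st.1 st.2].
have [P' [sP' P'P P'e P'c]] :=
  sublinear_linear_attained [seq e st | st : S * S] c sP.
have sumfE (h : V) : h = \sum_st h st *: e st.
  apply/ffunP => x; rewrite sum_ffunE (bigD1 x)//= !ffunE eqxx /= big1 => [|y yx].
    by rewrite addr0 /GRing.scale/= mulr1.
  by rewrite !ffunE eq_sym (negbTE yx) /GRing.scale/= mulr0.
have Psum (r : seq (S * S)) (a : S * S -> R) :
    P' (\sum_(st <- r) a st *: e st) = \sum_(st <- r) a st * P' (e st) /\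
    linear_at P' (\sum_(st <- r) a st *: e st).
  elim: r => [|st r [ih1 ih2]].
    by rewrite !big_nil sublinear0// /linear_at oppr0 sublinear0// oppr0.
  have lst : linear_at P' (a st *: e st).
    by apply: linear_atZ => //; apply: P'e; apply/mapP; exists st; rewrite ?mem_enum.
  rewrite !big_cons linear_atE// ih1; split; last exact: linear_atD.
  congr (_ + _); have [a0|a0] := leP 0 (a st); first exact: sublinearZ.
  have := sublinearZ (e st) sP' (ltW (_ : 0 < - a st)); rewrite oppr_gt0 => /(_ a0).
  have := sublinearN (a st *: e st) sP'; move: lst; rewrite /linear_at -scaleNr => h1 h2 h3.
  by apply/eqP; rewrite eq_le; move: h1 h2; rewrite h3 mulNr !lerN2 => -> ->.
have P'E (h : V) : P' h = \sum_st h st * P' (e st).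
  by rewrite {1}(sumfE h); have [-> _] := Psum (index_enum _) h.
have P'N (h : V) : P' (- h) = - P' h.
  by rewrite !P'E -sumrN; apply: eq_bigr => st _; rewrite ffunE mulNr.
have P'uv (u v : S -> R) :
    \sum_s \sum_t (u s + v t) * P' (e (s, t)) = val (u, v).
  pose h : V := [ffun st => u st.1 + v st.2].
  have -> : \sum_s \sum_t (u s + v t) * P' (e (s, t)) = P' h.
    by rewrite P'E pair_bigA; apply: eq_bigr => -[s t] _; rewrite ffunE.
  apply/eqP; rewrite eq_le; apply/andP; split.
    by apply: le_trans (P'P _) _; apply: Ple => s t; rewrite ffunE.
  rewrite -lerN2 -P'N (le_trans (P'P _))//.
  have -> : - val (u, v) = val (fun s => - u s, fun s => - v s).
    rewrite /val/= opprD -!sumrN.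
    by congr (_ + _); apply: eq_bigr => s _; rewrite mulrN.
  by apply: Ple => s t; rewrite !ffunE/= opprD.
exists (fun s t => P' (e (s, t))); split.
- move=> s t; rewrite -oppr_le0 -P'N (le_trans (P'P _))//.
  apply: (@le_trans _ _ (val (fun=> 0, fun=> 0))).
    by apply: Ple => s' t'; rewrite !ffunE addr0 oppr_le0.
  by rewrite /val/= !big1 ?addr0// => *; rewrite mulr0.
- move=> s; have := P'uv (fun s' => (s' == s)%:R) (fun=> 0); rewrite /val/=.
  rewrite (bigD1 s)//= eqxx.
  under eq_bigr do rewrite addr0 mul1r.
  rewrite [X in _ + X]big1 ?addr0 => [->|s' /negbTE ->]; last first.
    by rewrite big1// => t _; rewrite addr0 mul0r.
  rewrite [X in _ + X]big1 => [|t _]; last by rewrite mulr0.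
  rewrite (bigD1 s)//= eqxx mulr1 [X in p s + X]big1 ?addr0// => s' /negbTE ->.
  by rewrite mulr0.
- move=> t; have := P'uv (fun=> 0) (fun s' => (s' == t)%:R); rewrite /val/=.
  rewrite exchange_big/= (bigD1 t)//= eqxx.
  under eq_bigr do rewrite add0r mul1r.
  rewrite [X in _ + X]big1 ?addr0 => [->|s' /negbTE ->]; last first.
    by rewrite big1// => s _; rewrite addr0 mul0r.
  rewrite [X in X + _]big1 => [|s _]; last by rewrite mulr0.
  rewrite (bigD1 t)//= eqxx mulr1 [X in q t + X]big1 ?addr0 ?add0r// => s' /negbTE ->.
  by rewrite mulr0.
- have -> : \sum_s \sum_t P' (e (s, t)) * dist s t = P' (- c).
    rewrite P'E pair_bigA; apply: eq_bigr => -[s t] _.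
    by rewrite !ffunE/= opprK mulrC.
  apply: (le_trans P'c); rewrite lerNl; apply: Pge => u v huv.
  have -> : val (u, v) = - (\sum_s p s * - u s + \sum_s q s * - v s).
    rewrite /val/= opprD -!sumrN.
    by congr (_ + _); apply: eq_bigr => s _; rewrite mulrN opprK.
  rewrite lerN2; apply: dual_pair_le => // s t.
  by have := huv s t; rewrite ffunE/=; lra.
Qed.

End FiniteDual.

(** * Finite product probability *)

Section FiniteProbability.
Context {R : realType} {U : finType} (w : U -> R).
Hypothesis w_ge0 : forall u, 0 <= w u.
Hypothesis w_sum : \sum_u w u = 1.
Implicit Types (f g : seq U -> R) (n : nat).

(* Expectation of [f (u_1, ..., u_n)] for [u_1, ..., u_n] independent with law [w]. *)
Fixpoint Ex n f : R :=
  if n is m.+1 then \sum_u w u * Ex m (fun s => f (u :: s)) else f [::].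

Lemma le_Ex n f g : (forall s, size s = n -> f s <= g s) -> Ex n f <= Ex n g.
Proof.
elim: n f g => [|n ih] f g h /=; first exact: h.
by apply: ler_sum => u _; rewrite ler_wpM2l// ih// => s sn; apply: h => /=; rewrite sn.
Qed.

Lemma eq_Ex n f g : (forall s, size s = n -> f s = g s) -> Ex n f = Ex n g.
Proof.
by move=> h; apply/eqP; rewrite eq_le !le_Ex// => s /h ->.
Qed.

Lemma ExD n f g : Ex n (fun s => f s + g s) = Ex n f + Ex n g.
Proof.
elim: n f g => //= n ih f g; rewrite -big_split; apply: eq_bigr => u _ /=.
by rewrite ih mulrDr.
Qed.

Lemma ExZ n a f : Ex n (fun s => a * f s) = a * Ex n f.
Proof.
elim: n f => //= n ih f; rewrite mulr_sumr; apply: eq_bigr => u _.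
by rewrite ih mulrCA.
Qed.

Lemma Ex_cst n a : Ex n (fun=> a) = a.
Proof. by elim: n => //= n ->; rewrite -mulr_suml w_sum mul1r. Qed.

Lemma Ex_sum n (I : Type) (r : seq I) (F : I -> seq U -> R) :
  Ex n (fun s => \sum_(i <- r) F i s) = \sum_(i <- r) Ex n (F i).
Proof.
elim: r => [|i r ih].
  by under eq_Ex do rewrite big_nil; rewrite big_nil Ex_cst.
under eq_Ex do rewrite big_cons; rewrite ExD ih big_cons//.
Qed.

(** Replaces Hoeffding's lemma: the linear term vanishes in expectation for a centered variable. The
    factor 2 leaves room for an elementary case split at -1, 0 and 1. *)
Lemma expR_le_Dsqr (y : R) : expR y <= y + expR (2 * y ^+ 2).
Proof.
have key : 1 + 2 * y ^+ 2 <= expR (2 * y ^+ 2) by exact: expR_ge1Dx.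
have [y1|y1] := ltP 1 y.
  suff : expR y <= expR (2 * y ^+ 2) by lra.
  by rewrite ler_expR; nra.
have [y0|y0] := leP y 0.
  have [ym1|ym1] := leP y (-1).
    have : expR y <= 1 by rewrite -expR0 ler_expR.
    nra.
  suff : expR y <= 1 + y + y ^+ 2 by nra.
  have := expR_ge1Dx (- y); rewrite expRN => h.
  rewrite -[leLHS]invrK invf_ple ?posrE ?invr_gt0 ?expR_gt0//; last by nra.
  apply: le_trans h; rewrite -div1r ler_pdivrMr; nra.
suff : expR y <= 1 + y + 2 * y ^+ 2 by nra.
have -> : expR y = expR (y / 2) ^+ 2.
  by rewrite expr2 -expRD; congr expR; lra.
have := expR_ge1Dx (- (y / 2)); rewrite expRN => h.
have h2 : expR (y / 2) <= (1 - y / 2)^-1.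
  rewrite -[leLHS]invrK lef_pV2 ?posrE ?invr_gt0 ?expR_gt0//; lra.
apply: (@le_trans _ _ ((1 - y / 2)^-1 ^+ 2)).
  by rewrite ler_pXn2r ?nnegrE ?expR_ge0// invr_ge0; lra.
rewrite exprVn -div1r ler_pdivrMr; last by rewrite exprn_gt0//; lra.
(* This product is four times (1 + y + 2 y^2) (1 - y/2)^2 - 1. *)
have : 0 <= y ^+ 2 * ((1 - y) * (5 - 2 * y)) by rewrite mulr_ge0 ?sqr_ge0// mulr_ge0; lra.
nra.
Qed.

Lemma expR_centered (y : U -> R) (c : R) : \sum_u w u * y u = 0 ->
  (forall u, `|y u| <= c) -> \sum_u w u * expR (y u) <= expR (2 * c ^+ 2).
Proof.
move=> y0 yc.
apply: (@le_trans _ _ (\sum_u (w u * y u + w u * expR (2 * c ^+ 2)))).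
  apply: ler_sum => u _; rewrite -mulrDr ler_wpM2l// (le_trans (expR_le_Dsqr _))//.
  rewrite lerD2l ler_expR ler_wpM2l// -[y u ^+ 2]real_normK ?num_real//.
  by rewrite ler_pXn2r ?nnegrE// (le_trans _ (yc u)).
by rewrite big_split/= y0 add0r -mulr_suml w_sum mul1r.
Qed.

Definition bounded_differences n f (c : R) := forall s1 s2 u v,
  (size s1 + size s2).+1 = n -> f (s1 ++ u :: s2) - f (s1 ++ v :: s2) <= c.

(** Doob's martingale argument as an induction: [g u] is the mean given the first sample. Its
    deviation from the full mean is centered and at most [c] in absolute value, and the remaining
    samples are handled by the induction hypothesis. *)
Lemma mgf_bounded_differences n f (c l : R) : bounded_differences n f c ->
  Ex n (fun s => expR (l * (f s - Ex n f))) <= expR (2 * n%:R * (l * c) ^+ 2).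
Proof.
elim: n f => [|n ih] f fc.
  by rewrite /= subrr mulr0 mulr0 mul0r lexx.
pose g u := Ex n (fun s => f (u :: s)).
have gc u v : g u - g v <= c.
  rewrite -[X in _ <= X](Ex_cst n) lerBlDr -ExD; apply: le_Ex => s sn.
  by rewrite -lerBlDr (fc [::])//= add0n sn.
have gE : Ex n.+1 f = \sum_u w u * g u by [].
have c_abs u : `|l * (g u - Ex n.+1 f)| <= `|l| * c.
  rewrite normrM ler_wpM2l//.
  have gm : g u - Ex n.+1 f = \sum_v w v * (g u - g v).
    under eq_bigr do rewrite mulrBr.
    by rewrite sumrB -mulr_suml w_sum mul1r gE.
  rewrite gm (le_trans (ler_norm_sum _ _ _))//.
  rewrite -[leRHS]mul1r -w_sum mulr_suml; apply: ler_sum => v _.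
  rewrite normrM ger0_norm// ler_wpM2l// ler_norml gc andbT lerNl opprB.
  exact: gc.
have -> : (l * c) ^+ 2 = (`|l| * c) ^+ 2.
  by rewrite !exprMn -[in RHS]normrX ger0_norm ?sqr_ge0.
rewrite -[n.+1%:R]natr1 mulrDr mulr1 mulrDl expRD.
apply: (@le_trans _ _ (\sum_u w u * (expR (2 * n%:R * (`|l| * c) ^+ 2) *
    expR (l * (g u - Ex n.+1 f))))).
  apply: ler_sum => u _; rewrite ler_wpM2l//.
  have fuc : bounded_differences n (fun s => f (u :: s)) c.
    by move=> s1 s2 u' v' h; apply: (fc (u :: s1)); rewrite /= addSn h.
  have := ih _ fuc.
  have -> : (l * c) ^+ 2 = (`|l| * c) ^+ 2.
    by rewrite !exprMn -[in RHS]normrX ger0_norm ?sqr_ge0.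
  move=> /(ler_wpM2r (expR_ge0 (l * (g u - Ex n.+1 f)))); apply: le_trans.
  rewrite mulrC -ExZ; apply: le_Ex => s _; rewrite -expRD ler_expR -/(g u).
  rewrite /=; lra.
under eq_bigr do rewrite mulrCA.
rewrite -mulr_sumr ler_wpM2l ?expR_ge0//.
apply: expR_centered => //.
under eq_bigr do rewrite mulrCA mulrBr.
by rewrite -mulr_sumr sumrB -mulr_suml w_sum mul1r gE subrr mulr0.
Qed.

Theorem mcdiarmid n f (c e : R) : (0 < n)%N -> 0 < c -> 0 < e ->
  bounded_differences n f c ->
  Ex n (fun s => (Ex n f + e <= f s)%R%:R) <= expR (- (e ^+ 2 / (8 * n%:R * c ^+ 2))).
Proof.
move=> n0 c0 e0 fc.
have nR : 0 < n%:R :> R by rewrite ltr0n.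
(* The minimizer of - l e + 2 n l^2 c^2, with minimum - e^2 / (8 n c^2). *)
pose l := e / (4 * n%:R * c ^+ 2).
have l0 : 0 < l by rewrite divr_gt0// !mulr_gt0// exprn_gt0.
apply: (@le_trans _ _ (Ex n (fun s => expR (- (l * e)) * expR (l * (f s - Ex n f))))).
  apply: le_Ex => s _; rewrite -expRD.
  have [h|_] := leP (Ex n f + e) (f s); last exact: expR_ge0.
  rewrite -[leLHS]expR0 ler_expR -mulrN -mulrDr mulr_ge0 ?(ltW l0)//; lra.
rewrite ExZ.
apply: (@le_trans _ _ (expR (- (l * e)) * expR (2 * n%:R * (l * c) ^+ 2))).
  by rewrite ler_wpM2l ?expR_ge0// mgf_bounded_differences.
rewrite -expRD ler_expR le_eqVlt; apply/orP; left; apply/eqP.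
by rewrite /l; field; rewrite !gt_eqF.
Qed.

(** The offset [a] carries the samples already drawn through the induction; the cross terms vanish
    by centering. *)
Lemma Ex_sqr_sum n (Z : U -> R) (a : R) : \sum_u w u * Z u = 0 ->
  Ex n (fun s => (a + \sum_(u <- s) Z u) ^+ 2) = a ^+ 2 + n%:R * \sum_u w u * Z u ^+ 2.
Proof.
move=> Z0; elim: n a => [|n ih] a; first by rewrite /= big_nil addr0 mul0r addr0.
rewrite [LHS]/=.
transitivity (\sum_u w u * ((a + Z u) ^+ 2 + n%:R * \sum_u w u * Z u ^+ 2)).
  apply: eq_bigr => u _; rewrite -ih; congr (_ * _); apply: eq_Ex => s _.
  by rewrite big_cons addrA.
under eq_bigr do rewrite sqrrD mulrDr -addrA.
rewrite big_split/= -mulr_suml w_sum.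
have -> : \sum_u w u * (a ^+ 2 + (a * Z u *+ 2 + Z u ^+ 2)) =
   a ^+ 2 + \sum_u w u * Z u ^+ 2.
  transitivity (\sum_u (w u * a ^+ 2 + 2 * a * (w u * Z u) + w u * Z u ^+ 2)).
    by apply: eq_bigr => u _; ring.
  by rewrite !big_split/= -mulr_suml w_sum -mulr_sumr Z0 mulr0 addr0 mul1r.
by rewrite -[n.+1%:R]natr1; ring.
Qed.

(** * Deviation of empirical frequencies *)

Section Deviation.
Context {K : finType} (kappa : U -> K).

Definition weight (k : K) : R := \sum_(u | kappa u == k) w u.
Definition freq (s : seq U) (k : K) : R :=
  (size s)%:R^-1 * \sum_(u <- s) (kappa u == k)%:R.

(** The variance of a Bernoulli average; p - p^2 is bounded by p so that the bounds can be summed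
    over the cells. *)
Lemma Ex_freq_weight_sqr n k : (0 < n)%N ->
  Ex n (fun s => (freq s k - weight k) ^+ 2) <= weight k / n%:R.
Proof.
move=> n0; have nR : 0 < n%:R :> R by rewrite ltr0n.
pose Z u : R := (kappa u == k)%:R - weight k.
have wE : \sum_u w u * (kappa u == k)%:R = weight k.
  by rewrite /weight [RHS]big_mkcond; apply: eq_bigr => u _; case: eqP; rewrite ?mulr1 ?mulr0.
have Z0 : \sum_u w u * Z u = 0.
  under eq_bigr do rewrite mulrBr.
  by rewrite sumrB wE -mulr_suml w_sum mul1r subrr.
have := Ex_sqr_sum n 0 Z0; rewrite expr0n add0r => V.
have -> : Ex n (fun s => (freq s k - weight k) ^+ 2) =
    n%:R ^- 2 * Ex n (fun s => (0 + \sum_(u <- s) Z u) ^+ 2).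
  rewrite -ExZ; apply: eq_Ex => s sn; rewrite add0r -exprVn -exprMn; congr (_ ^+ 2).
  rewrite /freq /Z sumrB mulrBr big_const_seq count_predT iter_addr_0 sn.
  by rewrite -[weight k *+ n]mulr_natl mulKf// gt_eqF.
rewrite V.
have Zle : \sum_u w u * Z u ^+ 2 <= weight k.
  have -> : \sum_u w u * Z u ^+ 2 = weight k - weight k ^+ 2.
    transitivity (\sum_u (w u * (kappa u == k)%:R + w u * (- 2 * (kappa u == k)%:R * weight k
      + weight k ^+ 2))).
      apply: eq_bigr => u _; rewrite /Z; case: eqP => _ /=; ring.
    rewrite big_split/= wE.
    under eq_bigr do rewrite mulrDr.
    rewrite big_split/= -mulr_suml w_sum.
    have -> : \sum_u w u * (- 2 * (kappa u == k)%:R * weight k) = - 2 * weight k ^+ 2.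
      transitivity (\sum_u - 2 * weight k * (w u * (kappa u == k)%:R)).
        by apply: eq_bigr => u _; ring.
      by rewrite -mulr_sumr wE expr2 mulrA.
    ring.
  by rewrite gerBl sqr_ge0.
rewrite -exprVn expr2 mulrA mulfVK ?gt_eqF// mulrC.
by rewrite ler_wpM2r// invr_ge0 ltW.
Qed.

(* [|y| <= (t y^2 + 1/t) / 2] with [t = sqrt (#|A| n)], instead of Cauchy-Schwarz *)
Lemma Ex_freq_weight n (A : {set K}) : (0 < n)%N -> (0 < #|A|)%N ->
  Ex n (fun s => \sum_(k in A) `|freq s k - weight k|) <= Num.sqrt (#|A|%:R / n%:R).
Proof.
move=> n0 K0; have nR : 0 < n%:R :> R by rewrite ltr0n.
have KR : 0 < #|A|%:R :> R by rewrite ltr0n.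
pose t : R := Num.sqrt (#|A|%:R * n%:R).
have t0 : 0 < t by rewrite sqrtr_gt0 mulr_gt0.
have amgm (y : R) : `|y| <= t / 2 * y ^+ 2 + (2 * t)^-1.
  rewrite -[y ^+ 2]real_normK ?num_real//.
  have := sqr_ge0 (t * `|y| - 1); rewrite sqrrB1 => h.
  have : 0 <= ((t * `|y|) ^+ 2 - t * `|y| *+ 2 + 1) / (2 * t).
    by rewrite divr_ge0// mulr_ge0// ltW.
  have -> : ((t * `|y|) ^+ 2 - t * `|y| *+ 2 + 1) / (2 * t) =
     t / 2 * `|y| ^+ 2 + (2 * t)^-1 - `|y|.
    by field; rewrite gt_eqF.
  by rewrite subr_ge0.
apply: (@le_trans _ _ (\sum_(k in A) (t / 2 * (weight k / n%:R) + (2 * t)^-1))).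
  under eq_Ex do rewrite big_mkcond.
  rewrite Ex_sum [leRHS]big_mkcond; apply: ler_sum => k _.
  case: ifP => // _; last by rewrite Ex_cst.
  apply: (@le_trans _ _ (Ex n (fun s => t / 2 * (freq s k - weight k) ^+ 2 + (2 * t)^-1))).
    by apply: le_Ex => s _; exact: amgm.
  rewrite ExD ExZ Ex_cst lerD2r ler_wpM2l ?divr_ge0 ?(ltW t0)//.
  exact: Ex_freq_weight_sqr.
rewrite big_split/= -mulr_sumr -mulr_suml sumr_const -[_^-1 *+ _]mulr_natl.
have sA : \sum_(k in A) weight k <= 1.
  rewrite -w_sum /weight [leRHS](partition_big kappa xpredT)//= [leLHS]big_mkcond.
  by apply: ler_sum => k _; case: ifP => // _; apply: sumr_ge0.
have -> : Num.sqrt (#|A|%:R / n%:R) = t / n%:R :> R.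
  rewrite /t !sqrtrM ?ler0n// sqrtrV ?ler0n//.
  rewrite -[X in _ * _ / X]sqr_sqrtr ?ler0n//; field.
  by rewrite sqrtr_eq0 -ltNge.
have tt : #|A|%:R = t ^+ 2 / n%:R :> R.
  by rewrite sqr_sqrtr ?mulr_ge0 ?ler0n// mulfK ?gt_eqF.
(* By the choice of [t] both terms equal t / (2 n). *)
apply: (@le_trans _ _ (t / 2 * (1 / n%:R) + #|A|%:R / (2 * t))).
  by rewrite lerD2r ler_wpM2l ?divr_ge0 ?(ltW t0)// ler_wpM2r// invr_ge0 ltW.
rewrite tt le_eqVlt; apply/orP; left; apply/eqP; field.
by rewrite !gt_eqF.
Qed.

End Deviation.

(** * From finite sums to probabilities of events *)

Section Transfer.
Context {d : measure_display} {Omega : measurableType d} (P : probability Omega R).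
Context (Y : nat -> Omega -> U).
Hypothesis mY : forall n u, measurable (Y n @^-1` [set u]).
Hypothesis PY : forall n (t : nat -> U),
  P (\bigcap_(i in [set i | i \in iota 0 n]) (Y i @^-1` [set t i])) =
  (\prod_(i <- iota 0 n) w (t i))%:E.

(** Induction on the number of samples still unread: the event with prefix [t] is the disjoint
    finite union, over the next value u, of the events with prefix [rcons t u]. With nothing left to
    read it is a cylinder or empty. *)
Lemma transfer_prefix (B : seq U -> bool) n (t : seq U) :
  let E := [set x | mkseq (fun i => Y i x) (size t) = t /\
    B (mkseq (fun i => Y i x) (size t + n))] in
  measurable E /\
  P E = (\prod_(u <- t) w u * Ex n (fun s => (B (t ++ s))%:R))%:E.
Proof.
elim: n t => [|n ih] t E.
  have EE : E = if B t then [set x | mkseq (fun i => Y i x) (size t) = t] else set0.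
    apply/seteqP; split=> x; rewrite /E/= addn0.
      by move=> [tE]; rewrite tE => ->.
    by case: ifPn => // Bt /= ->.
  rewrite EE /= cats0; case: ifPn => Bt; last first.
    by rewrite measure0 mulr0; split.
  (* [nth] needs a default element. If [U] is empty, the prefix is empty and the event is the whole
     space. *)
  have [u0|U0] := pickP (pred_of_simpl (@predT U)); last first.
    case: t Bt {E EE} => [|u t]; last by have := U0 u.
    move=> _; rewrite big_nil mulr1 (_ : [set _ | _] = setT) ?probability_setT//.
    by apply/seteqP.
  move=> _.
  have tE : [set x | mkseq (fun i => Y i x) (size t) = t] =
      \bigcap_(i in [set i | i \in iota 0 (size t)]) (Y i @^-1` [set nth u0 t i]).
    apply/seteqP; split => x /=.
      move=> xt i /=; rewrite mem_iota/= add0n => it.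
      by rewrite -[in RHS]xt nth_mkseq.
    move=> h; apply: (@eq_from_nth _ u0); first by rewrite size_mkseq.
    move=> i; rewrite size_mkseq => it; rewrite nth_mkseq//.
    by apply: h; rewrite /= mem_iota.
  rewrite tE PY; split.
    by apply: fin_bigcap_measurable => //; exact: finite_seq.
  by rewrite mulr1 -[in RHS](mkseq_nth u0 t) big_map/index_iota.
have EE : E = \bigcup_(u in [set: U])
    [set x | mkseq (fun i => Y i x) (size (rcons t u)) = rcons t u /\
      B (mkseq (fun i => Y i x) (size (rcons t u) + n))].
  apply/seteqP; split => x; rewrite /E/=.
    move=> [xt xB]; exists (Y (size t) x) => //=.
    by rewrite size_rcons addSnnS mkseqS xt.
  move=> [u _] /=; rewrite size_rcons mkseqS addSnnS => -[/rcons_inj[-> _]] //.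
rewrite EE; split.
  apply: fin_bigcup_measurable; first exact: finite_finset.
  by move=> u _; exact: (ih _).1.
rewrite measure_fin_bigcup//=; last 2 first.
- apply/trivIsetP => u v _ _ uv; apply/seteqP; split=> x //= [[xu _] [xv _]].
  move: uv; rewrite !size_rcons in xu xv.
  by move: xv; rewrite xu => /rcons_inj[->]; rewrite eqxx.
- by move=> u _; exact: (ih _).1.
have -> : [set: U] = [set` enum U].
  by apply/seteqP; split=> u //= _; rewrite mem_enum.
rewrite -fsbig_seq ?enum_uniq// big_enum/= mulr_sumr -sumEFin.
apply: eq_bigr => u _; rewrite (ih (rcons t u)).2 -cats1 big_cat big_seq1/= mulrA.
by congr (_ * _)%:E; apply: eq_Ex => s _; rewrite -catA.
Qed.

Theorem transfer (B : seq U -> bool) n :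
  let E := [set x | B (mkseq (fun i => Y i x) n)] in
  measurable E /\ P E = (Ex n (fun s => (B s)%:R))%:E.
Proof.
have := transfer_prefix B n [::]; rewrite big_nil mul1r /= add0n => -[].
have -> : [set x | [::] = [::] :> seq U /\ B (mkseq (fun i => Y i x) n)] =
    [set x | B (mkseq (fun i => Y i x) n)].
  by apply/seteqP; split => x //= -[].
by [].
Qed.

End Transfer.

End FiniteProbability.

(** * Euclidean distance and finite partitions *)

Section FiniteFactor.
Context {d : measure_display} {X : measurableType d} {R : realType} {S : finType}.
Context (i : X -> S).
Hypothesis mi : forall s, measurable (i @^-1` [set s]).

Lemma measurable_finite_preimage (P : set S) : measurable (i @^-1` P).
Proof.
have -> : i @^-1` P = \bigcup_(s in P) (i @^-1` [set s]).
  by apply/seteqP; split=> [x Px|x [s Ps /= xs]]; [exists (i x)|rewrite /preimage/= xs].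
by apply: fin_bigcup_measurable => [|s _]; [exact: finite_finset|exact: mi].
Qed.

Lemma measurable_fun_finite d' (Y : measurableType d') (v : S -> Y) :
  measurable_fun setT (v \o i).
Proof.
by move=> _ A _; rewrite setTI comp_preimage; exact: measurable_finite_preimage.
Qed.

Lemma ge0_integral_finite (mu : {measure set X -> \bar R}) (v : S -> R) :
  (forall s, 0 <= v s) ->
  (\int[mu]_x (v (i x))%:E = \sum_s (v s)%:E * mu (i @^-1` [set s]))%E.
Proof.
move=> v0.
have vE x : (v (i x))%:E = (\sum_s (v s * \1_(i @^-1` [set s]) x)%:E)%E.
  rewrite sumEFin (bigD1 (i x))//= indicE mem_set// mulr1 big1 ?addr0// => s si.
  by rewrite indicE memNset ?mulr0// => /= /eqP; rewrite eq_sym (negbTE si).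
under eq_integral do rewrite vE.
rewrite ge0_integral_sum//=; last 2 first.
- move=> s; apply/measurable_EFinP; apply: measurable_funM => //.
- by move=> s x _; rewrite lee_fin mulr_ge0.
apply: eq_bigr => s _.
under eq_integral do rewrite EFinM.
rewrite ge0_integralZl//; last 2 first.
- exact/measurable_EFinP.
- by rewrite lee_fin.
by rewrite integral_indic// setIT.
Qed.

Lemma sum_measure_cells (mu : {measure set X -> \bar R}) A : measurable A ->
  (\sum_s mu (A `&` i @^-1` [set s]) = mu A)%E.
Proof.
move=> mA.
have -> : (mu A = mu (\bigcup_(s in [set: S]) (A `&` i @^-1` [set s])))%E.
  congr (mu _); rewrite -setI_bigcupr; apply/seteqP; split=> [x Ax|x []//].
  by split => //; exists (i x).
rewrite measure_fin_bigcup//=; last 2 first.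
- apply/trivIsetP => s t _ _ /eqP st; apply/seteqP; split=> x //= [[_ xs] [_ xt]].
  by apply: st; rewrite -xs -xt.
- by move=> s _; exact: measurableI.
have -> : [set: S] = [set` enum S].
  by apply/seteqP; split=> u //= _; rewrite mem_enum.
by rewrite -fsbig_seq ?enum_uniq// big_enum.
Qed.

Lemma sum_fine_cells (mu : probability X R) A : measurable A ->
  (\sum_s fine (mu (A `&` i @^-1` [set s])))%:E = mu A.
Proof.
move=> mA; rewrite -sumEFin -[RHS]sum_measure_cells//; apply: eq_bigr => s _.
by rewrite fineK//; apply: fin_num_measure; exact: measurableI.
Qed.

Lemma sum_cell_mass (mu : probability X R) :
  \sum_s fine (mu (i @^-1` [set s])) = 1.
Proof.
have := @sum_fine_cells mu setT measurableT; under eq_bigr do rewrite setTI.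
by move=> h; apply: EFin_inj; rewrite h; exact: probability_setT.
Qed.

End FiniteFactor.

Section Euclid.
Context {R : realType} {d : nat}.
Implicit Types x y z : 'rV[R]_d.

Lemma eucl_ge0 x y : 0 <= eucl x y.
Proof. exact: sqrtr_ge0. Qed.

Lemma euclxx x : eucl x x = 0.
Proof. by rewrite /eucl big1 ?sqrtr0// => i _; rewrite subrr expr0n. Qed.

Lemma euclC x y : eucl x y = eucl y x.
Proof.
by rewrite /eucl; congr Num.sqrt; apply: eq_bigr => i _; rewrite -opprB sqrrN.
Qed.

Lemma sum_sqr_ge0 (a : 'I_d -> R) : 0 <= \sum_i a i ^+ 2.
Proof. by apply: sumr_ge0 => i _; exact: sqr_ge0. Qed.

Lemma cauchy_schwarz (a b : 'I_d -> R) :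
  \sum_i a i * b i <= Num.sqrt (\sum_i a i ^+ 2) * Num.sqrt (\sum_i b i ^+ 2).
Proof.
set A := Num.sqrt _; set B := Num.sqrt _.
have A2 : \sum_i a i ^+ 2 = A ^+ 2 by rewrite sqr_sqrtr// sum_sqr_ge0.
have B2 : \sum_i b i ^+ 2 = B ^+ 2 by rewrite sqr_sqrtr// sum_sqr_ge0.
have zero (c e : 'I_d -> R) : \sum_i c i ^+ 2 = 0 -> \sum_i c i * e i <= 0.
  move=> /eqP; rewrite psumr_eq0 => [/allP c0|i _]; last exact: sqr_ge0.
  rewrite big1// => i _; have := c0 i; rewrite mem_index_enum sqrf_eq0.
  by move=> /(_ isT)/eqP ->; rewrite mul0r.
have [A0|A0] := eqVneq A 0.
  by rewrite A0 mul0r zero// A2 A0 expr0n.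
have [B0|B0] := eqVneq B 0.
  rewrite B0 mulr0; under eq_bigr do rewrite mulrC.
  by rewrite zero// B2 B0 expr0n.
have Ap : 0 < A by rewrite lt_neqAle eq_sym A0 sqrtr_ge0.
have Bp : 0 < B by rewrite lt_neqAle eq_sym B0 sqrtr_ge0.
have : 0 <= \sum_i (B * a i - A * b i) ^+ 2 by exact: sum_sqr_ge0.
have -> : \sum_i (B * a i - A * b i) ^+ 2 =
    2 * (A * B) * (A * B - \sum_i a i * b i).
  transitivity (\sum_i (B ^+ 2 * a i ^+ 2 + - (2 * (A * B)) * (a i * b i) + A ^+ 2 * b i ^+ 2)).
    by apply: eq_bigr => i _; ring.
  by rewrite !big_split/= -!mulr_sumr A2 B2; ring.
by rewrite pmulr_rge0 ?subr_ge0// !mulr_gt0.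
Qed.

Lemma eucl_tri x y z : eucl x z <= eucl x y + eucl y z.
Proof.
rewrite -(@ler_pXn2r _ 2) ?nnegrE ?addr_ge0 ?eucl_ge0//.
rewrite sqrrD /eucl !sqr_sqrtr ?sum_sqr_ge0//.
set a := fun i => x ord0 i - y ord0 i; set b := fun i => y ord0 i - z ord0 i.
have -> : \sum_i (x ord0 i - z ord0 i) ^+ 2 =
    \sum_i a i ^+ 2 + (\sum_i a i * b i) *+ 2 + \sum_i b i ^+ 2.
  rewrite -sumrMnl -!big_split; apply: eq_bigr => i _ /=; rewrite /a /b; ring.
by rewrite lerD2r lerD2l ler_wMn2r// cauchy_schwarz.
Qed.

Lemma eucl_le (x y : 'rV[R]_d) (e : R) : 0 <= e ->
  (forall i, `|x ord0 i - y ord0 i| <= e) -> eucl x y <= Num.sqrt d%:R * e.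
Proof.
move=> e0 h.
rewrite -[e in leRHS]ger0_norm// -sqrtr_sqr -sqrtrM ?ler0n// ler_wsqrtr//.
rewrite mulr_natl -[X in _ *+ X]card_ord -sumr_const; apply: ler_sum => i _.
by rewrite -[leLHS]real_normK ?num_real// ler_pXn2r ?nnegrE.
Qed.

Local Notation T := (Rd R d).

Lemma measurable_coord (i : 'I_d) : measurable_fun setT (fun x : T => x ord0 i).
Proof.
apply: (measurability _ (RGenOpens.measurableE R)).
move=> _ [_ [a [b ->] <-]]; rewrite setTI; apply: sub_sigma_algebra => /=.
apply: (open_comp _ (interval_open _ _)) => //.
by move=> x _; exact: coord_continuous.
Qed.

Lemma measurable_cube : measurable (@cube R d).
Proof.
have -> : @cube R d = \bigcap_(i in [set: 'I_d]) ((fun x : T => x ord0 i) @^-1` `[0, 1]).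
  apply/seteqP; split=> [x h i _|x h i]; first by rewrite /= in_itv/= h.
  by have := h i I; rewrite /= in_itv.
apply: fin_bigcap_measurable => [|i _]; first exact: finite_finset.
by rewrite -[X in measurable X]setTI; apply: measurable_coord.
Qed.

Lemma measurable_eucl : measurable_fun setT (fun z : T * T => eucl z.1 z.2).
Proof.
apply: (@measurableT_comp _ _ _ _ _ _ (@Num.sqrt R)).
  exact: (continuous_measurable_fun (@sqrt_continuous R)).
apply: measurable_sum => i.
apply: (@measurableT_comp _ _ _ _ _ _ (fun x : R => x ^+ 2)); first exact: exprn_measurable.
apply: measurable_funB.
  exact: (measurableT_comp (measurable_coord i) measurable_fst).
exact: (measurableT_comp (measurable_coord i) measurable_snd).
Qed.

End Euclid.

(** * Discretization of W1 *)

(** Kernel values and empirical measures are typed as measures only. Normalizing one of mass 1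
    changes its type and not its values. *)
Lemma probability_of_measure {R : realType} d (X : measurableType d)
  (m : {measure set X -> \bar R}) : m setT = 1%E ->
  exists p : probability X R, p = m :> (set X -> \bar R).
Proof.
move=> m1.
have [x _] : exists x : X, True.
  have [//|X0] := pselect (exists x : X, True).
  exfalso; move: m1; rewrite (_ : setT = set0); first by rewrite measure0 => -[/esym/eqP]; rewrite oner_eq0.
  by apply/seteqP; split=> // x _; apply: X0; exists x.
exists (mnormalize m (\d_x)); apply/funext => A.
by change (mnormalize m (\d_x) A = m A); rewrite /mnormalize m1 onee_eq0/= invr1 mule1.
Qed.

(** * Lifting a finite transport plan to a coupling *)

Section Mixture.
Context {R : realType} {d : measure_display} {T : measurableType d} {S : finType}.
Context (i : T -> S) (x0 : T).
Hypothesis mi : forall s, measurable (i @^-1` [set s]).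
Context (alpha beta : probability T R) (m : S -> S -> R).
Let a s := fine (alpha (i @^-1` [set s])).
Let b s := fine (beta (i @^-1` [set s])).
Hypothesis m_ge0 : forall s t, 0 <= m s t.
Hypothesis m1 : forall s, \sum_t m s t = a s.
Hypothesis m2 : forall t, \sum_s m s t = b t.

(* Product of conditional laws on each pair of cells, weighted by [m]. *)
Lemma cell_coupling : exists g : probability (T * T)%type R,
  [/\ forall A, measurable A -> g (A `*` setT) = alpha A,
      forall A, measurable A -> g (setT `*` A) = beta A &
      forall s t, g ((i @^-1` [set s]) `*` (i @^-1` [set t])) = (m s t)%:E].
Proof.
have a0 s : 0 <= a s by rewrite fine_ge0.
have b0 s : 0 <= b s by rewrite fine_ge0.
pose Q (p : S * S) := (i @^-1` [set p.1]) `*` (i @^-1` [set p.2]).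
have mQ p : measurable (Q p) by apply: measurableX.
have w0 (p : S * S) : 0 <= m p.1 p.2 / (a p.1 * b p.2) by rewrite divr_ge0// mulr_ge0.
pose M p : {measure set (T * T)%type -> \bar R} :=
  mscale (NngNum (w0 p)) (mrestr (alpha \x beta)%E (mQ p)).
pose p0 := (i x0, i x0).
pose g : {measure set (T * T)%type -> \bar R} :=
  msum (fun n => M (nth p0 (enum {: S * S}) n)) (size (enum {: S * S})).
pose aA A s := fine (alpha (A `&` i @^-1` [set s])).
pose bB B s := fine (beta (B `&` i @^-1` [set s])).
have gE A B : measurable A -> measurable B ->
    g (A `*` B) = (\sum_s \sum_t m s t / (a s * b t) * (aA A s * bB B t))%:E.
  move=> mA mB.
  transitivity (\sum_(n < size (enum {: S * S})) M (nth p0 (enum {: S * S}) n) (A `*` B))%E.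
    by [].
  rewrite -(big_mkord xpredT (fun n => M (nth p0 (enum {: S * S}) n) (A `*` B))).
  rewrite -(big_nth p0 xpredT (fun p => M p (A `*` B))) big_enum/=.
  rewrite pair_bigA -sumEFin; apply: eq_bigr => -[s t] _ /=.
  transitivity ((m s t / (a s * b t))%:E *
      (alpha \x beta) ((A `*` B) `&` Q (s, t)))%E; first by [].
  rewrite /Q -setXI product_measure1E; last 2 first.
  - exact: measurableI.
  - exact: measurableI.
  rewrite [RHS]EFinM; congr (_ * _)%E; rewrite EFinM /aA /bB.
  by rewrite !fineK// fin_num_measure//; exact: measurableI.
have aAT s : aA setT s = a s by rewrite /aA setTI.
have bBT s : bB setT s = b s by rewrite /bB setTI.
(* On null rows and columns the weight m / (a b) is 0, as the inverse of 0 is 0. No mass is lost,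
   since [m] vanishes there. *)
have m_a s t : a s = 0 -> m s t = 0.
  move=> as0; have := m1 s; rewrite as0 => /eqP.
  rewrite psumr_eq0 => [/allP/(_ t)|//]; rewrite mem_index_enum => /(_ isT).
  by move=> /eqP.
have m_b s t : b t = 0 -> m s t = 0.
  move=> bt0; have := m2 t; rewrite bt0 => /eqP.
  rewrite psumr_eq0 => [/allP/(_ s)|//]; rewrite mem_index_enum => /(_ isT).
  by move=> /eqP.
have le_cell (gamma : probability T R) A s : measurable A ->
    fine (gamma (A `&` i @^-1` [set s])) <= fine (gamma (i @^-1` [set s])).
  move=> mA; apply: fine_le.
  - by apply: fin_num_measure; exact: measurableI.
  - by apply: fin_num_measure.
  by apply: le_measure; rewrite ?inE; [exact: measurableI|exact: mi|exact: subIsetr].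
have g1 A : measurable A -> g (A `*` setT) = alpha A.
  move=> mA; rewrite gE// -(sum_fine_cells mi)//; congr (_%:E); apply: eq_bigr => s _.
  transitivity (\sum_t m s t * (aA A s / a s)).
    apply: eq_bigr => t _; rewrite bBT; have [bt0|bt0] := eqVneq (b t) 0.
      by rewrite bt0 m_b// !mul0r.
    (* The inverse is generalized because [a s] may be zero; only [b t] has to cancel. *)
    by rewrite invfM; move: (a s)^-1 => x; field.
  rewrite -mulr_suml m1 mulrC; have [as0|as0] := eqVneq (a s) 0; last by rewrite divfK.
  rewrite as0 mulr0; apply/esym/eqP; rewrite eq_le fine_ge0// andbT -[leRHS]as0.
  exact: le_cell.
have g2 A : measurable A -> g (setT `*` A) = beta A.
  move=> mA; rewrite gE// -(sum_fine_cells mi)// exchange_big/=; congr (_%:E); apply: eq_bigr => t _.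
  transitivity (\sum_s m s t * (bB A t / b t)).
    apply: eq_bigr => s _; rewrite aAT; have [as0|as0] := eqVneq (a s) 0.
      by rewrite as0 m_a// !mul0r.
    by rewrite invfM; move: (b t)^-1 => x; field.
  rewrite -mulr_suml m2 mulrC; have [bt0|bt0] := eqVneq (b t) 0; last by rewrite divfK.
  rewrite bt0 mulr0; apply/esym/eqP; rewrite eq_le fine_ge0// andbT -[leRHS]bt0.
  exact: le_cell.
have gT : g setT = 1%E by rewrite -setXTT g1// probability_setT.
have [g' g'E] := probability_of_measure gT.
exists g'; rewrite g'E; split => // s t; rewrite gE//; congr (_%:E).
have cell_self (gamma : probability T R) s1 s2 :
    fine (gamma (i @^-1` [set s1] `&` i @^-1` [set s2])) =
    if s2 == s1 then fine (gamma (i @^-1` [set s1])) else 0.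
  case: eqP => [->|s12]; first by rewrite setIid.
  rewrite (_ : _ `&` _ = set0) ?measure0//.
  by apply/seteqP; split=> x //= [xs xt]; apply: s12; rewrite -xs -xt.
rewrite (bigD1 s)//= [X in _ + X]big1 ?addr0 => [|s' /negbTE ss']; last first.
  by rewrite big1// => t' _; rewrite /aA cell_self ss' mul0r mulr0.
rewrite (bigD1 t)//= [X in _ + X]big1 ?addr0 => [|t' /negbTE tt']; last first.
  by rewrite /bB cell_self tt' !mulr0.
rewrite /aA /bB !cell_self !eqxx.
have [as0|as0] := eqVneq (a s) 0; first by rewrite m_a// !mul0r.
have [bt0|bt0] := eqVneq (b t) 0; first by rewrite m_b// !mul0r.
by rewrite -mulrA mulVf ?mulr1// mulf_neq0.
Qed.

End Mixture.

Section Discretization.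
Context {R : realType} {d : nat} {S : finType}.
Local Notation T := (Rd R d).
Context (i : T -> S) (c : S -> T) (h B : R).
Hypothesis mi : forall s, measurable (i @^-1` [set s]).
Hypothesis h_ge0 : 0 <= h.
Hypothesis ih : forall x, cube x -> eucl x (c (i x)) <= h.
Hypothesis dist_B : forall s t, eucl (c s) (c t) <= B.

Definition center_dist s t : R := eucl (c s) (c t).
Local Notation kr := (kr center_dist B).

Lemma eucl_center x y : cube x -> cube y ->
  `|eucl x y - center_dist (i x) (i y)| <= 2 * h.
Proof.
move=> /ih hx /ih hy; rewrite /center_dist ler_norml.
have := eucl_tri x (c (i x)) y; have := eucl_tri (c (i x)) (c (i y)) y.
have := eucl_tri (c (i x)) x (c (i y)); have := eucl_tri x y (c (i y)).
rewrite (euclC (c (i x)) x) (euclC (c (i y)) y); lra.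
Qed.

Let B_ge0 (s : S) : 0 <= B.
Proof. by apply: le_trans (dist_B s s); exact: eucl_ge0. Qed.

Context (alpha beta : probability T R).
Hypothesis alpha_cube : alpha cube = 1%E.
Hypothesis beta_cube : beta cube = 1%E.

Lemma coupling_cube (g : probability (T * T)%type R) : coupling alpha beta g ->
  {ae g, forall z, cube z.1 /\ cube z.2}.
Proof.
move=> [g1 g2]; pose Z : set (T * T) := (~` cube `*` setT) `|` (setT `*` ~` cube).
have mc := @measurable_cube R d.
have mZ1 : measurable (~` @cube R d `*` [set: T]).
  by apply: measurableX => //; exact: measurableC.
have mZ2 : measurable ([set: T] `*` ~` @cube R d).
  by apply: measurableX => //; exact: measurableC.
exists Z; split; first exact: measurableU.
  have Z1 : g (~` @cube R d `*` [set: T]) = 0%E.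
    by rewrite g1; [rewrite probability_setC// alpha_cube subee|exact: measurableC].
  have Z2 : g ([set: T] `*` ~` @cube R d) = 0%E.
    by rewrite g2; [rewrite probability_setC// beta_cube subee|exact: measurableC].
  by rewrite measureU0.
move=> z /= hz; rewrite /Z; have [z1|z1] := pselect (cube z.1); last by left.
by right; split => //= z2; apply: hz.
Qed.

Let mi2 (s : S * S) : measurable ((fun z : T * T => (i z.1, i z.2)) @^-1` [set s]).
Proof.
have -> : (fun z : T * T => (i z.1, i z.2)) @^-1` [set s] =
   (i @^-1` [set s.1]) `*` (i @^-1` [set s.2]).
  by case: s => s t; apply/seteqP; split=> z /=; case=> -> ->.
exact: measurableX.
Qed.

Local Notation mass gamma s := (fine (gamma (i @^-1` [set s]))).

(** The easy half of duality: a potential on the cells is tested against an arbitrary coupling, each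
    point being within [h] of its center. *)
Lemma kr_le_W1 (s0 : S) : ((kr (fun s => mass alpha s - mass beta s))%:E <=
  W1 alpha beta + (2 * h)%:E)%E.
Proof.
rewrite -leeBlDr//; apply: le_ereal_inf_tmp => _ [g cg <-].
rewrite leeBlDr//; have := coupling_cube cg; case: cg => g1 g2 gc.
set I := (\int[g]_z _)%E.
have I0 : (0 <= I)%E by apply: integral_ge0 => z _; rewrite lee_fin eucl_ge0.
have [Ioo|] := eqVneq I +oo%E; first by rewrite Ioo leey.
rewrite -ltey => Ioo.
have -> : I = (fine I)%:E by rewrite fineK// ge0_fin_numE.
rewrite -EFinD lee_fin.
apply: kr_le => [*||u [ul uB]]; [exact: eucl_ge0|exact: B_ge0 s0|].
(* Nonnegative, so integrals split without integrability conditions. The added constant cancels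
   between two laws of mass 1. *)
pose v s := u s + B.
have v0 s : 0 <= v s by have := uB s; rewrite /v ler_norml; lra.
have gi1 s : g ((fun z => i z.1) @^-1` [set s]) = alpha (i @^-1` [set s]).
  by rewrite -g1//; congr (g _); apply/seteqP; split=> z //= [].
have gi2 s : g ((fun z => i z.2) @^-1` [set s]) = beta (i @^-1` [set s]).
  by rewrite -g2//; congr (g _); apply/seteqP; split=> z //= [].
have mi1' s : measurable ((fun z : T * T => i z.1) @^-1` [set s]).
  by rewrite -[X in measurable X]setTI; exact: (measurable_fst measurableT _ (mi s)).
have mi2' s : measurable ((fun z : T * T => i z.2) @^-1` [set s]).
  by rewrite -[X in measurable X]setTI; exact: (measurable_snd measurableT _ (mi s)).
have sumE (gamma : probability T R) :
    (\sum_s (v s)%:E * gamma (i @^-1` [set s]))%E =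
    (\sum_s u s * fine (gamma (i @^-1` [set s])) +
     B * \sum_s fine (gamma (i @^-1` [set s])))%:E.
  rewrite mulr_sumr -big_split -sumEFin; apply: eq_bigr => s _ /=.
  by rewrite -mulrDl EFinM fineK// fin_num_measure.
have : (\int[g]_z (v (i z.1))%:E <=
    \int[g]_z ((v (i z.2))%:E + ((eucl z.1 z.2)%:E + (2 * h)%:E)))%E.
  apply: ae_ge0_le_integral => //.
  - by move=> z _; rewrite lee_fin.
  - apply/measurable_EFinP; exact: (measurable_fun_finite mi1').
  - by move=> z _; rewrite -!EFinD lee_fin addr_ge0 ?v0 ?addr_ge0 ?eucl_ge0 ?mulr_ge0.
  - apply/measurable_EFinP; apply: measurable_funD.
      exact: (measurable_fun_finite mi2').
    by apply: measurable_funD => //; exact: measurable_eucl.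
  apply: filterS gc => z [z1 z2] _; rewrite -!EFinD lee_fin.
  have := ul (i z.1) (i z.2); have := eucl_center z1 z2.
  rewrite ler_norml /v; lra.
rewrite ge0_integralD//=; last 4 first.
- by move=> z _; rewrite lee_fin.
- apply/measurable_EFinP; exact: (measurable_fun_finite mi2').
- by move=> z _; rewrite -!EFinD lee_fin addr_ge0 ?v0 ?addr_ge0 ?eucl_ge0 ?mulr_ge0.
- apply/measurable_EFinP; apply: measurable_funD => //; exact: measurable_eucl.
rewrite ge0_integralD//=; last 3 first.
- by move=> z _; rewrite lee_fin eucl_ge0.
- apply/measurable_EFinP; exact: measurable_eucl.
- by move=> z _; rewrite lee_fin mulr_ge0.
have -> : (\int[g]_z (v (i z.1))%:E = (\sum_s u s * mass alpha s + B)%:E)%E.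
  rewrite (ge0_integral_finite mi1')//.
  rewrite -[B in RHS]mulr1 -[X in B * X](sum_cell_mass mi alpha) -sumE.
  by apply: eq_bigr => s _; congr (_ * _)%E; exact: gi1.
have -> : (\int[g]_z (v (i z.2))%:E = (\sum_s u s * mass beta s + B)%:E)%E.
  rewrite (ge0_integral_finite mi2')//.
  rewrite -[B in RHS]mulr1 -[X in B * X](sum_cell_mass mi beta) -sumE.
  by apply: eq_bigr => s _; congr (_ * _)%E; exact: gi2.
rewrite integral_cst// -/I [X in (_ * X)%E](probability_setT g) mule1.
have -> : I = (fine I)%:E by rewrite fineK// ge0_fin_numE.
rewrite -!EFinD lee_fin.
under [X in _ -> X <= _]eq_bigr do rewrite mulrBr.
rewrite sumrB; lra.
Qed.

(** The hard half: an optimal plan between the cell masses is lifted to a coupling of [alpha] and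
    [beta], and replacing points by centers costs at most 2 h. *)
Lemma W1_le_kr (s0 : S) :
  (W1 alpha beta <= (kr (fun s => mass alpha s - mass beta s) + 2 * h)%:E)%E.
Proof.
have [m [m0 m1 m2 mkr]] := finite_kantorovich (fun s => euclxx (c s))
  (fun s t r => eucl_tri (c s) (c t) (c r)) dist_B
  (fun s => fine_ge0 (measure_ge0 alpha (i @^-1` [set s])))
  (fun s => fine_ge0 (measure_ge0 beta (i @^-1` [set s])))
  (sum_cell_mass mi alpha) (sum_cell_mass mi beta).
have [g [g1 g2 g12]] := cell_coupling (c s0) mi m0 m1 m2.
have cg : coupling alpha beta g by split.
have gc := coupling_cube cg.
apply: (@le_trans _ _ (\int[g]_z (eucl z.1 z.2)%:E)%E).
  by apply: ereal_inf_lbound; exists g.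
apply: (@le_trans _ _ (\int[g]_z ((center_dist (i z.1) (i z.2))%:E + (2 * h)%:E))%E).
  apply: ae_ge0_le_integral => //.
  - by move=> z _; rewrite lee_fin eucl_ge0.
  - apply/measurable_EFinP; exact: measurable_eucl.
  - by move=> z _; rewrite -!EFinD lee_fin addr_ge0 ?eucl_ge0 ?mulr_ge0.
  - apply/measurable_EFinP; apply: measurable_funD => //.
    exact: (measurable_fun_finite mi2 (fun p => center_dist p.1 p.2)).
  apply: filterS gc => z [z1 z2] _; rewrite -!EFinD lee_fin.
  have := eucl_center z1 z2; rewrite ler_norml; lra.
rewrite ge0_integralD//=; last 3 first.
- by move=> z _; rewrite lee_fin eucl_ge0.
- apply/measurable_EFinP.
  exact: (measurable_fun_finite mi2 (fun p => center_dist p.1 p.2)).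
- by move=> z _; rewrite lee_fin mulr_ge0.
rewrite integral_cst// [X in (_ * X)%E](probability_setT g) mule1 EFinD leeD2r//.
rewrite (ge0_integral_finite mi2 g (v := fun p => center_dist p.1 p.2)); last first.
  by move=> s; exact: eucl_ge0.
apply: le_trans (_ : ((\sum_s \sum_t m s t * center_dist s t)%:E <= _)%E) => //.
rewrite pair_bigA -sumEFin le_eqVlt; apply/orP; left; apply/eqP; apply: eq_bigr => -[s t] _ /=.
rewrite mulrC EFinM -g12; congr (_ * g _)%E.
by apply/seteqP; split=> z /=; case=> -> ->.
Qed.

End Discretization.

(** Both halves for plain measures of mass 1, the form in which kernel values and empirical measures
    arrive. It also provides the finiteness of [W1]. *)
Lemma W1_approx {R : realType} {d : nat} {S : finType}
    (i : Rd R d -> S) (c : S -> Rd R d) (h B : R)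
    (alpha beta : {measure set (Rd R d) -> \bar R}) (s0 : S) :
  (forall s, measurable (i @^-1` [set s])) -> 0 <= h ->
  (forall x, cube x -> eucl x (c (i x)) <= h) ->
  (forall s t, eucl (c s) (c t) <= B) ->
  alpha setT = 1%E -> beta setT = 1%E -> alpha cube = 1%E -> beta cube = 1%E ->
  exists2 r, W1 alpha beta = r%:E &
    `|r - kr (center_dist c) B
        (fun s => fine (alpha (i @^-1` [set s])) - fine (beta (i @^-1` [set s])))| <= 2 * h.
Proof.
move=> mi h0 ih dB aT bT.
have [a <-] := probability_of_measure aT; have [b <-] := probability_of_measure bT.
move=> ac bc; have lo := kr_le_W1 mi h0 ih dB ac bc s0.
have := W1_le_kr mi h0 ih dB ac bc s0; move: lo.
case: (W1 a b) => [r| |]; last 2 first.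
- by move=> _; rewrite leye_eq.
- by rewrite leeNy_eq.
rewrite -EFinD !lee_fin => lo hi; exists r => //.
by rewrite ler_norml; apply/andP; split; lra.
Qed.

(** * The plug-in functional *)

Lemma sum_freq_fiber {R : realType} {U K : finType} (kappa : U -> K)
  (s : seq U) k :
  \sum_(u | kappa u == k) freq (R := R) id s u = freq kappa s k.
Proof.
rewrite /freq -mulr_sumr; congr (_ * _); rewrite exchange_big/=.
apply: eq_bigr => u _; rewrite [LHS]big_mkcond (bigD1 u)//= eqxx big1 ?addr0; first by case: eqP.
by move=> v /negbTE vu; rewrite [u == v]eq_sym vu; case: ifP.
Qed.

Section Functional.
Context {R : realType} {S : finType} (dist : S -> S -> R) (B : R).
Hypothesis dist_ge0 : forall s t, 0 <= dist s t.
Hypothesis B_gt0 : 0 < B.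
Hypothesis distC : forall s t, dist s t = dist t s.
Implicit Types Q : S -> S -> R.

Let B_ge0 : 0 <= B. Proof. exact: ltW. Qed.
Local Notation kr := (kr dist B).

Definition marg1 Q s := \sum_t Q s t.
Definition marg2 Q t := \sum_s Q s t.

Definition dependence Q := \sum_s kr (fun t => Q s t - marg1 Q s * marg2 Q t).

Definition joint Q := (forall s t, 0 <= Q s t) /\ \sum_s \sum_t Q s t = 1.

(** Each row splits into the row difference, [marg1 Q] times the difference of second marginals, and
    the difference of first marginals times [marg2 Q']. The second marginal is the sum of the rows,
    so the first two pieces each cost the summed row distances; the third is bounded by its l1
    norm. *)
Lemma dependence_dist Q Q' : joint Q -> joint Q' ->
  `|dependence Q - dependence Q'| <=
  2 * \sum_s kr (fun t => Q s t - Q' s t) + B * \sum_s `|marg1 Q s - marg1 Q' s|.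
Proof.
move=> [Q0 Q1] [Q'0 Q'1].
rewrite /dependence -sumrB (le_trans (ler_norm_sum _ _ _))//.
have m1_ge0 s : 0 <= marg1 Q s by apply: sumr_ge0.
have m2_ge0 t : 0 <= marg2 Q' t by apply: sumr_ge0.
have m2_sum : \sum_t marg2 Q' t = 1 by rewrite exchange_big.
have kr2 : kr (fun t => marg2 Q t - marg2 Q' t) <= \sum_s kr (fun t => Q s t - Q' s t).
  rewrite -[leLHS](congr1 kr (_ : (fun t => \sum_s (Q s t - Q' s t)) = _)).
    exact: kr_sum.
  by apply/funext => t; rewrite sumrB.
pose bound s := kr (fun t => Q s t - Q' s t) +
  (marg1 Q s * kr (fun t => marg2 Q t - marg2 Q' t) + B * `|marg1 Q s - marg1 Q' s|).
apply: (@le_trans _ _ (\sum_s bound s)); last first.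
  rewrite !big_split/= -mulr_suml -mulr_sumr.
  by rewrite [\sum_s marg1 Q s]Q1 mul1r; lra.
apply: ler_sum => s _; rewrite (le_trans (kr_dist dist_ge0 B_ge0 distC _ _))//.
have -> : (fun t => Q s t - marg1 Q s * marg2 Q t - (Q' s t - marg1 Q' s * marg2 Q' t)) =
  (fun t => (Q s t - Q' s t) + ((marg1 Q s * - (marg2 Q t - marg2 Q' t)) +
     - ((marg1 Q s - marg1 Q' s) * marg2 Q' t))).
  by apply/funext => t; ring.
rewrite (le_trans (kr_add dist_ge0 B_ge0 _ _))// lerD2l.
rewrite (le_trans (kr_add dist_ge0 B_ge0 _ _))// lerD//.
  by rewrite krZ// krN.
rewrite krN//.
rewrite (le_trans (kr_norm1 dist_ge0 B_ge0 _))// ler_wpM2l//.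
under eq_bigr do rewrite normrM [`|marg2 _ _|]ger0_norm//.
by rewrite -mulr_sumr m2_sum mulr1.
Qed.

Definition empirical_joint (sigma : seq (S * S)) s t : R := freq id sigma (s, t).

Lemma marg1_empirical sigma s :
  marg1 (empirical_joint sigma) s = freq fst sigma s.
Proof.
rewrite /marg1 -sum_freq_fiber (eq_bigr (fun p => freq id sigma (p.1, p.2))); last by case.
rewrite (eq_bigl (fun p => (p.1 == s) && true)) => [|p]; last by rewrite andbT.
by rewrite -(pair_big (pred1 s) xpredT (fun a b => freq id sigma (a, b)))/= big_pred1_eq.
Qed.

Lemma marg2_empirical sigma t :
  marg2 (empirical_joint sigma) t = freq snd sigma t.
Proof.
rewrite /marg2 -sum_freq_fiber [RHS](eq_bigr (fun p => freq id sigma (p.1, p.2))); last by case.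
rewrite -(pair_big xpredT (pred1 t) (fun a b => freq id sigma (a, b)))/=.
by apply: eq_bigr => a _; rewrite big_pred1_eq.
Qed.

Lemma joint_empirical sigma : (0 < size sigma)%N -> joint (empirical_joint sigma).
Proof.
move=> s0; split=> [s t|].
  by rewrite mulr_ge0 ?invr_ge0// sumr_ge0.
rewrite pair_bigA/=; under eq_bigr => p _ do rewrite /empirical_joint -surjective_pairing.
rewrite /freq -mulr_sumr exchange_big/= (eq_bigr (fun=> 1)) => [|u _]; last first.
  by rewrite (bigD1 u)//= eqxx big1 ?addr0// => v /negbTE; rewrite eq_sym => ->.
rewrite big_const_seq count_predT iter_addr_0 mulVf//.
by rewrite pnatr_eq0 -lt0n.
Qed.

Context (w : S * S -> R).
Hypothesis w_ge0 : forall p, 0 <= w p.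
Hypothesis w_sum : \sum_p w p = 1.
Let W s t := w (s, t).

Lemma jointW : joint W.
Proof.
split=> [s t|]; first exact: w_ge0.
by rewrite pair_bigA/= -[RHS]w_sum; apply: eq_bigr => -[].
Qed.

Definition deviation sigma := `|dependence (empirical_joint sigma) - dependence W|.

Lemma empirical_joint_swap s1 s2 u v (n := (size s1 + size s2).+1) :
  \sum_s \sum_t `|empirical_joint (s1 ++ u :: s2) s t - empirical_joint (s1 ++ v :: s2) s t|
  <= 2 / n%:R.
Proof.
have sz x : size (s1 ++ x :: s2) = n by rewrite size_cat/= addnS.
rewrite pair_bigA/=.
apply: (@le_trans _ _ (\sum_p (n%:R^-1 * ((u == p)%:R + (v == p)%:R)))).
  apply: ler_sum => -[s t] _; rewrite /empirical_joint /freq !sz -mulrBr normrM.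
  rewrite ger0_norm ?invr_ge0// ler_wpM2l ?invr_ge0// !big_cat !big_cons/=.
  set x := \sum_(_ <- s1) _; set y := \sum_(_ <- s2) _.
  have -> : x + ((u == (s, t))%:R + y) - (x + ((v == (s, t))%:R + y)) =
     (u == (s, t))%:R - (v == (s, t))%:R :> R by ring.
  by rewrite (le_trans (ler_normB _ _))// !ger0_norm.
rewrite -mulr_sumr big_split/=.
have one x : \sum_(p : S * S) (x == p)%:R = 1 :> R.
  by rewrite (bigD1 x)//= eqxx big1 ?addr0// => p /negbTE; rewrite eq_sym => ->.
by rewrite !one mulrC.
Qed.

(** One swap changes the empirical law by at most 2/n in l1 norm. In [dependence_dist] this norm
    enters with weight 2 B through the rows and B through the marginal: 3 B times 2/n. *)
Lemma deviation_bounded_differences n :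
  bounded_differences n deviation (6 * B / n%:R).
Proof.
move=> s1 s2 u v; set s := s1 ++ u :: s2; set s' := s1 ++ v :: s2 => nE.
have sz x : size (s1 ++ x :: s2) = n by rewrite size_cat/= addnS.
have n0 : (0 < n)%N by rewrite -nE.
have j1 : joint (empirical_joint s) by apply: joint_empirical; rewrite sz.
have j2 : joint (empirical_joint s') by apply: joint_empirical; rewrite sz.
have h1 := dependence_dist j1 j2.
have h2 : deviation s - deviation s' <=
    `|dependence (empirical_joint s) - dependence (empirical_joint s')|.
  rewrite lerBlDr /deviation.
  have -> : dependence (empirical_joint s) - dependence W =
    (dependence (empirical_joint s) - dependence (empirical_joint s')) +
    (dependence (empirical_joint s') - dependence W) by ring.
  exact: ler_normD.
apply: (le_trans h2); apply: (le_trans h1).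
have := empirical_joint_swap s1 s2 u v; rewrite -/s -/s' nE; set D := \sum_s _ => hD.
have k1 : \sum_r kr (fun t => empirical_joint s r t - empirical_joint s' r t) <= B * D.
  by rewrite mulr_sumr; apply: ler_sum => r _; apply: kr_norm1.
have k2 : \sum_r `|marg1 (empirical_joint s) r - marg1 (empirical_joint s') r| <= D.
  by apply: ler_sum => r _; rewrite /marg1 -sumrB; exact: ler_norm_sum.
have k3 : B * D <= B * (2 / n%:R) by rewrite ler_wpM2l.
have k4 := ler_wpM2l B_ge0 k2.
have -> : 6 * B / n%:R = 3 * (B * (2 / n%:R)) by ring.
lra.
Qed.

Theorem deviation_concentration n (M e : R) : (0 < n)%N -> 0 < e ->
  Ex w n deviation <= M ->
  Ex w n (fun sigma => (M + e <= deviation sigma)%R%:R) <=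
  expR (- (n%:R * e ^+ 2 / (288 * B ^+ 2))).
Proof.
move=> n0 e0 hM; have nR : 0 < n%:R :> R by rewrite ltr0n.
have c0 : 0 < 6 * B / n%:R by rewrite divr_gt0// mulr_gt0.
have := mcdiarmid w_ge0 w_sum n0 c0 e0 (@deviation_bounded_differences n).
(* 288 is 8 times 6 squared. *)
have -> : e ^+ 2 / (8 * n%:R * (6 * B / n%:R) ^+ 2) = n%:R * e ^+ 2 / (288 * B ^+ 2).
  by field; rewrite !gt_eqF.
apply: le_trans; apply: le_Ex => // s _.
have [h|_] := leP (M + e) (deviation s); last by [].
by rewrite (le_trans _ h)// lerD2r.
Qed.

(* Level [l] of the multiscale structure sends each point to the representative
   [rho l s] of its cell; [rho 0] is the identity, [rho J] is constant. *)
Section Multiscale.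
Context (J : nat) (rho : nat -> S -> S) (delta : nat -> R).
Hypothesis rho0 : forall s, rho 0 s = s.
Hypothesis rhoS : forall l s, rho l.+1 (rho l s) = rho l.+1 s.
Hypothesis rhoJ : forall s t, rho J s = rho J t.
Hypothesis rho_dist : forall l s, (l < J)%N -> dist (rho l s) (rho l.+1 s) <= delta l.
Hypothesis delta_ge0 : forall l, 0 <= delta l.

Definition level l : {set S} := [set rho l s | s in S].

(** Telescoping of a potential along t, rho 1 t, ..., rho J t. The increment at scale l depends only
    on the level-l cell of t and is at most [delta l]; at the top the potential is constant and sees
    only the total mass of [f]. *)
Lemma kr_multiscale (f : S -> R) :
  kr f <= \sum_(l < J) delta l * \sum_(k in level l) `|\sum_(t | rho l t == k) f t|
    + B * `|\sum_t f t|.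
Proof.
apply: kr_le => // u [ul uB].
pose F l := \sum_t u (rho l t) * f t.
have -> : \sum_t u t * f t = F 0%N by apply: eq_bigr => t _; rewrite rho0.
have FJ : F J <= B * `|\sum_t f t|.
  have [t0 _|S0] := pickP (pred_of_simpl (@predT S)); last first.
    by rewrite /F big1 ?mulr_ge0// => t _; have := S0 t.
  have -> : F J = u (rho J t0) * \sum_t f t.
    by rewrite mulr_sumr; apply: eq_bigr => t _; rewrite (rhoJ t t0).
  by rewrite (le_trans (ler_norm _))// normrM ler_wpM2r.
have step l : (l < J)%N -> F l - F l.+1 <=
    delta l * \sum_(k in level l) `|\sum_(t | rho l t == k) f t|.
  move=> lJ; rewrite /F -sumrB.
  under eq_bigr do rewrite -mulrBl.
  rewrite (partition_big (rho l) (fun k => k \in level l)) => [|t _]; last exact: imset_f.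
  rewrite mulr_sumr; apply: ler_sum => k /imsetP[r _ kE].
  have -> : \sum_(t | true && (rho l t == k)) (u (rho l t) - u (rho l.+1 t)) * f t =
      (u k - u (rho l.+1 k)) * \sum_(t | rho l t == k) f t.
    rewrite mulr_sumr; apply: eq_bigr => t /eqP tk.
    by rewrite -rhoS tk.
  rewrite (le_trans (ler_norm _))// normrM ler_wpM2r//.
  have := rho_dist r lJ; rewrite -(rhoS l r) -kE => h.
  rewrite ler_norml lerNl opprB !(le_trans _ h)//.
  by rewrite (le_trans (ul _ _))// distC.
have : F 0%N - F J <= \sum_(l < J)
    delta l * \sum_(k in level l) `|\sum_(t | rho l t == k) f t|.
  have -> : F 0%N - F J = \sum_(l < J) (F l - F l.+1).
    rewrite -(big_mkord xpredT (fun l => F l - F l.+1)).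
    rewrite -[LHS]opprB -(telescope_sumr F (leq0n J)) -sumrN.
    by apply: eq_bigr => l _; rewrite opprB.
  by apply: ler_sum => l _; exact: step.
lra.
Qed.

(** At scale l the samples are classified by (s, rho l t), which gives the product of cardinals. In
    the term 3 B, one B is the marginal term of [dependence_dist]; the other two are twice the mass
    defect of the rows in [kr_multiscale], which is again the first marginal. *)
Lemma Ex_deviation n : (0 < n)%N ->
  Ex w n deviation <=
  2 * \sum_(l < J) delta l * Num.sqrt ((#|S| * #|level l|)%:R / n%:R)
  + 3 * B * Num.sqrt (#|S|%:R / n%:R).
Proof.
move=> n0.
have [s0 _|S0] := pickP (pred_of_simpl (@predT S)); last first.
  exfalso; have := w_sum; rewrite big1 => [/esym/eqP|[s]]; first by rewrite oner_eq0.
  by have := S0 s.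
have cS : (0 < #|S|)%N by apply/card_gt0P; exists s0.
pose kappa l (p : S * S) := (p.1, rho l p.2).
pose A l := finset.setX (finset.setT : {set S}) (level l).
have cA l : #|A l| = (#|S| * #|level l|)%N by rewrite finset.cardsX finset.cardsT.
have cA0 l : (0 < #|A l|)%N.
  by rewrite cA muln_gt0 cS card_gt0; apply/set0Pn; exists (rho l s0); exact: imset_f.
pose D1 (sigma : seq (S * S)) : R :=
  \sum_(s in (finset.setT : {set S})) `|freq fst sigma s - weight w fst s|.
pose Dl l (sigma : seq (S * S)) : R :=
  \sum_(k in A l) `|freq (kappa l) sigma k - weight w (kappa l) k|.
have m1E sigma s : marg1 (empirical_joint sigma) s - marg1 W s =
    freq fst sigma s - weight w fst s.
  rewrite marg1_empirical; congr (_ - _); rewrite /weight.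
  rewrite (eq_bigr (fun p => w (p.1, p.2))); last by case.
  rewrite (eq_bigl (fun p => (p.1 == s) && true)) => [|p]; last by rewrite andbT.
  by rewrite -(pair_big (pred1 s) xpredT (fun a b => w (a, b)))/= big_pred1_eq.
have fibE l (F : S * S -> R) s k :
    \sum_(t | rho l t == k) F (s, t) = \sum_(p | kappa l p == (s, k)) F p.
  rewrite [RHS](eq_bigr (fun p => F (p.1, p.2))); last by case.
  rewrite (eq_bigl (fun p => (p.1 == s) && (rho l p.2 == k))) => [|p]; last by [].
  rewrite -(pair_big (pred1 s) (fun t => rho l t == k) (fun a b => F (a, b)))/=.
  by rewrite big_pred1_eq.
have le_dev sigma : (0 < size sigma)%N ->
    deviation sigma <= 2 * \sum_(l < J) delta l * Dl l sigma + 3 * B * D1 sigma.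
  move=> sz; apply: (le_trans (dependence_dist (joint_empirical sz) jointW)).
  have -> : \sum_s `|marg1 (empirical_joint sigma) s - marg1 W s| = D1 sigma.
    by rewrite /D1 [RHS](eq_bigl xpredT) => [|s]; [apply: eq_bigr => s _; rewrite m1E|rewrite finset.in_setT].
  have : \sum_s kr (fun t => empirical_joint sigma s t - W s t) <=
     \sum_(l < J) delta l * Dl l sigma + B * D1 sigma.
    apply: (@le_trans _ _ (\sum_s (\sum_(l < J) delta l * \sum_(k in level l)
      `|\sum_(t | rho l t == k) (empirical_joint sigma s t - W s t)|
      + B * `|\sum_t (empirical_joint sigma s t - W s t)|))).
      by apply: ler_sum => s _; exact: kr_multiscale.
    rewrite big_split/= -mulr_sumr exchange_big/= lerD//; last first.
      rewrite ler_wpM2l// /D1 [leRHS](eq_bigl xpredT) => [|s]; last by rewrite finset.in_setT.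
      apply: ler_sum => s _.
      by rewrite -m1E /marg1 sumrB.
    apply: ler_sum => l _; rewrite -mulr_sumr ler_wpM2l//.
    rewrite /Dl le_eqVlt; apply/orP; left; apply/eqP.
    rewrite pair_big_dep/=; apply: eq_big => -[s k]/=; first by rewrite finset.in_setX finset.in_setT.
    by move=> _; rewrite sumrB /W (fibE l w) -sum_freq_fiber -(fibE l (freq id sigma)).
  lra.
apply: (@le_trans _ _ (Ex w n (fun sigma =>
    2 * \sum_(l < J) delta l * Dl l sigma + 3 * B * D1 sigma))).
  by apply: le_Ex => // s sn; apply: le_dev; rewrite sn.
rewrite ExD !ExZ Ex_sum// lerD//.
  rewrite ler_wpM2l//; apply: ler_sum => l _; rewrite ExZ ler_wpM2l//.
  by rewrite -cA; exact: Ex_freq_weight.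
rewrite ler_wpM2l ?mulr_ge0//.
by rewrite -[#|S|]finset.cardsT; apply: Ex_freq_weight => //; rewrite finset.cardsT.
Qed.

End Multiscale.
End Functional.

(** * Rates *)

Section Rates.
Context {R : realType} {d N : nat}.
Hypothesis d_gt0 : (0 < d)%N.
Hypothesis N_gt0 : (0 < N)%N.
Local Notation r := (@grid_r R d).
Local Notation M := (@cells R d N).

Let NR : 0 < N%:R :> R. Proof. by rewrite ltr0n. Qed.
Let N1 : 1 <= N%:R :> R. Proof. by rewrite ler1n. Qed.

Lemma grid_r_gt0 : 0 < r.
Proof. by rewrite /grid_r; case: ifP => _; rewrite invr_gt0// ?mulr_gt0// ltr0n. Qed.

(** Equivalently r d - 1 <= - 2 r: the fluctuation sqrt (M^d / N) of a marginal does not exceed the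
    mesh scale N^(-r). Equality holds for d = 1 and d = 2. *)
Lemma grid_r_le : r * (d%:R + 2) <= 1.
Proof.
rewrite /grid_r; case: eqP => [->|d1]; first by lra.
have d2 : 2 <= d%:R :> R by rewrite ler_nat; lia.
by rewrite ler_pdivrMl; lra.
Qed.

Lemma cells_le : M%:R <= N%:R `^ r :> R.
Proof. by rewrite /cells truncn_le ?powR_ge0. Qed.

Lemma cells_gt0 : (0 < M)%N.
Proof.
rewrite /cells truncn_gt0 -[leLHS](powRr0 N%:R).
by apply: ler_powR => //; rewrite ltW// grid_r_gt0.
Qed.

(** Rounding N^r down loses at most a factor 2, because N^r < M + 1 <= 2 M. *)
Lemma invr_cells_le : M%:R^-1 <= 2 * N%:R `^ (- r) :> R.
Proof.
have M0 : 0 < M%:R :> R by rewrite ltr0n cells_gt0.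
have M1 : 1 <= M%:R :> R by rewrite ler1n cells_gt0.
have h : N%:R `^ r < M%:R + 1 :> R by rewrite natr1 truncnS_gt.
have p0 : 0 < N%:R `^ r :> R by rewrite powR_gt0.
rewrite powRN ler_pdivlMr// ler_pdivrMl//; lra.
Qed.

Lemma ln2_ge : 1 <= 2 * ln 2 :> R.
Proof.
have := @le_ln1Dx R (- 2^-1); rewrite (_ : 1 + - 2^-1 = 2^-1); last by lra.
by rewrite lnV ?posrE// => /(_ _) h; have := h ltac:(lra); lra.
Qed.

(** The factor 2 is for d = 2, where the logarithm is at least ln 2 >= 1/2. *)
Lemma powR_rate_le : N%:R `^ (- r) <= 2 * @rate R d N.
Proof.
rewrite /rate /grid_r; have p0 a : 0 <= N%:R `^ a :> R by exact: powR_ge0.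
case: eqP => [_|_]; first by have := p0 (- 3^-1); lra.
case: eqP => [->|_]; last by have := p0 (- (2 * d%:R)^-1); lra.
have -> : (2 * 2%:R)^-1 = 4^-1 :> R by congr _^-1; lra.
have : 1 <= 2 * ln N.+1%:R :> R.
  apply: (le_trans ln2_ge); rewrite ler_wpM2l// ler_ln ?posrE ?ltr0n// ler_nat; lia.
by have := p0 (- 4^-1); nra.
Qed.

Lemma cells_pow_le (k : nat) (a : R) : r * k%:R - 1 <= - 2 * a ->
  Num.sqrt (M%:R ^+ k / N%:R) <= N%:R `^ (- a) :> R.
Proof.
move=> h; have p0 : 0 <= N%:R `^ (- a) :> R by exact: powR_ge0.
rewrite -[leRHS](ger0_norm p0) -sqrtr_sqr ler_wsqrtr//.
have -> : (N%:R `^ (- a)) ^+ 2 = N%:R `^ (- 2 * a) :> R.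
  by rewrite -powR_mulrn// -powRrM; congr (_ `^ _); lra.
apply: (@le_trans _ _ (N%:R `^ (r * k%:R - 1))); last exact: ler_powR.
rewrite powRD; last by rewrite (gt_eqF NR) implybT.
rewrite powRN powRr1 ?ler0n// ler_wpM2r ?invr_ge0 ?ler0n//.
by rewrite powRrM powR_mulrn ?powR_ge0// lerXn2r ?nnegrE ?powR_ge0 ?ler0n// cells_le.
Qed.

Lemma sqrt_cells_le : Num.sqrt (M%:R ^+ d / N%:R) <= N%:R `^ (- r) :> R.
Proof. by apply: cells_pow_le; have := grid_r_le; lra. Qed.

Local Notation J := (up_log 2 M).

Lemma expn_up_log_le : (2 ^ J <= 2 * M)%N.
Proof.
have := cells_gt0; case: (ltnP 1 M) => [M1 _|]; last by move=> *; rewrite (_ : M = 1%N) ?up_log1//; lia.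
have := up_log_gtn (isT : (1 < 2)%N) M1.
have : (0 < J)%N by rewrite up_log_gt0.
by case: J => // J' _ /=; rewrite expnS; lia.
Qed.

(** Exactly the bound that closes the inductions for the two geometric sums below with constants 3
    and 4. *)
Lemma sqrt2_ge : 4 / 3 <= Num.sqrt 2 :> R.
Proof.
have -> : 4 / 3 = Num.sqrt ((4 / 3) ^+ 2) :> R by rewrite sqrtr_sqr ger0_norm.
by rewrite ler_wsqrtr//; lra.
Qed.

Lemma sum_sqrt_expn n : \sum_(l < n) Num.sqrt (2 ^+ l) <= 3 * Num.sqrt (2 ^+ n) :> R.
Proof.
elim: n => [|n ih]; first by rewrite big_ord0 mulr_ge0// sqrtr_ge0.
rewrite big_ord_recr/= exprS sqrtrM//.
have := sqrt2_ge; have := sqrtr_ge0 (2 ^+ n : R); nra.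
Qed.

Lemma sum_sqrt_expnV n : \sum_(l < n) Num.sqrt (2 ^- l) <= 4 - 4 * Num.sqrt (2 ^- n) :> R.
Proof.
elim: n => [|n ih]; first by rewrite big_ord0 expr0 invr1 sqrtr1; lra.
rewrite big_ord_recr/=.
have -> : Num.sqrt (2 ^- n.+1) = (Num.sqrt 2)^-1 * Num.sqrt (2 ^- n) :> R.
  by rewrite exprS invfM sqrtrM ?invr_ge0// [Num.sqrt 2^-1]sqrtrV.
have s34 : (Num.sqrt 2)^-1 <= 3 / 4 :> R.
  have := sqrt2_ge => h; rewrite -[leRHS]invrK lef_pV2 ?posrE ?sqrtr_gt0//; lra.
have := ler_wpM2r (sqrtr_ge0 (2 ^- n : R)) s34; have := sqrtr_ge0 (2 ^- n : R); lra.
Qed.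

(** The chaining sum up to constants, without the factor sqrt (M^d / N) of the coordinate that is
    not coarsened: scale l has mesh 2^l / M and about (M / 2^l)^d cells. *)
Definition scale_sum : R :=
  \sum_(l < J) 2 ^+ l / M%:R * Num.sqrt ((M%:R / 2 ^+ l) ^+ d).

Lemma scale_sum_le :
  Num.sqrt (M%:R ^+ d / N%:R) * scale_sum <= 16 * @rate R d N.
Proof.
have M0 : 0 < M%:R :> R by rewrite ltr0n cells_gt0.
have q0 : 0 <= Num.sqrt (M%:R ^+ d / N%:R) :> R by exact: sqrtr_ge0.
have p2 l : 0 < 2 ^+ l :> R by rewrite exprn_gt0.
have rate0 : 0 <= N%:R `^ (- r) :> R by exact: powR_ge0.
case: (ltngtP d 2) => d2.
- have d1 : d = 1%N by lia.
  have h : scale_sum <= 6.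
    have -> : scale_sum =
        (Num.sqrt M%:R)^-1 * \sum_(l < J) Num.sqrt (2 ^+ l) :> R.
      rewrite mulr_sumr; apply: eq_bigr => l _.
      have -> : (M%:R / 2 ^+ l) ^+ d = M%:R / 2 ^+ l :> R.
        by rewrite -[RHS]expr1; congr (_ ^+ _).
      rewrite sqrtrM ?ler0n// sqrtrV ?ltW//.
      rewrite -{1}[2 ^+ l]sqr_sqrtr ?ltW// -{1}[M%:R]sqr_sqrtr ?ler0n//.
      by field; rewrite !sqrtr_eq0 -!ltNge p2 M0.
    rewrite ler_pdivrMl ?sqrtr_gt0// (le_trans (sum_sqrt_expn _))//.
    have : Num.sqrt (2 ^+ J) <= 2 * Num.sqrt M%:R :> R.
      have -> : 2 * Num.sqrt M%:R = Num.sqrt (4 * M%:R) :> R.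
        by rewrite sqrtrM// (_ : 4 = 2 ^+ 2) ?sqrtr_sqr ?ger0_norm//; lra.
      rewrite ler_wsqrtr// -natrX -natrM ler_nat (leq_trans expn_up_log_le)//; lia.
    lra.
  apply: (@le_trans _ _ (N%:R `^ (- r) * 6)).
    apply: ler_pM => //; last exact: sqrt_cells_le.
    by apply: sumr_ge0 => l _; rewrite mulr_ge0 ?sqrtr_ge0// divr_ge0 ?ltW.
  have := powR_rate_le; lra.
- have h1 : Num.sqrt (M%:R ^+ d / N%:R) * scale_sum <= 4 * N%:R `^ (- r).
    have h2 : scale_sum <= 4 * Num.sqrt (M%:R ^+ (d - 2)).
      apply: (@le_trans _ _ (\sum_(l < J) Num.sqrt (M%:R ^+ (d - 2)) * Num.sqrt (2 ^- l))).
        apply: ler_sum => l _.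
        have -> : 2 ^+ l / M%:R * Num.sqrt ((M%:R / 2 ^+ l) ^+ d) =
           Num.sqrt ((M%:R / 2 ^+ l) ^+ (d - 2)) :> R.
          have -> : (M%:R / 2 ^+ l) ^+ d = (M%:R / 2 ^+ l) ^+ (d - 2) * (M%:R / 2 ^+ l) ^+ 2 :> R.
            by rewrite -exprD; congr (_ ^+ _); lia.
          rewrite sqrtrM ?exprn_ge0 ?divr_ge0 ?ltW//.
          rewrite sqrtr_sqr ger0_norm ?divr_ge0 ?ltW//; field.
          by rewrite !gt_eqF.
        rewrite -sqrtrM ?exprn_ge0 ?ler0n// ler_wsqrtr// expr_div_n ler_wpM2l ?exprn_ge0 ?ler0n//.
        rewrite lef_pV2 ?posrE ?exprn_gt0// -exprM ler_eXn2l ?ltr1n//.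
        by rewrite -[X in (X <= _)%N]muln1 leq_mul2l subn_gt0 d2 orbT.
      rewrite -mulr_sumr mulrC ler_wpM2r ?sqrtr_ge0//.
      by rewrite (le_trans (sum_sqrt_expnV _))// gerBl mulr_ge0 ?sqrtr_ge0.
    apply: (le_trans (ler_wpM2l q0 h2)).
    rewrite mulrCA ler_wpM2l// -sqrtrM ?divr_ge0 ?exprn_ge0 ?ler0n//.
    have -> : M%:R ^+ d / N%:R * M%:R ^+ (d - 2) = M%:R ^+ (2 * d - 2) / N%:R :> R.
      by rewrite mulrAC -exprD; congr (_ ^+ _ / _); lia.
    apply: cells_pow_le.
    have -> : (2 * d - 2)%:R = 2 * d%:R - 2 :> R by rewrite natrB ?natrM//; lia.
    (* For d >= 3 the finest scale gives sqrt (M^(2d-2) / N), and r = 1/(2d) is the exponent at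
       which r (2d - 2) - 1 = - 2 r. *)
    have : r * (2 * d%:R) = 1.
      rewrite /grid_r; case: eqP => [d1|_]; first by lia.
      by rewrite mulVf// mulf_neq0// pnatr_eq0; lia.
    lra.
  apply: (le_trans h1).
  have := powR_rate_le; lra.
- have JE : scale_sum = J%:R.
    rewrite /scale_sum (eq_bigr (fun=> 1)) ?sumr_const ?card_ord// => l _.
    have -> : (M%:R / 2 ^+ l) ^+ d = (M%:R / 2 ^+ l) ^+ 2 :> R by congr (_ ^+ _).
    rewrite sqrtr_sqr ger0_norm ?divr_ge0 ?ltW//.
    by field; rewrite !gt_eqF.
  have hJ : J%:R <= 4 * ln N.+1%:R :> R.
    (* From 2^J <= 2 M <= 2 N <= (N + 1)^2. *)
    have lN : ln (2 ^+ J) <= ln (N.+1%:R ^+ 2) :> R.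
      rewrite ler_ln ?posrE ?exprn_gt0 ?ltr0n// -!natrX ler_nat.
      rewrite (leq_trans expn_up_log_le)//.
      have : (M <= N)%N.
        rewrite -(ler_nat R) (le_trans cells_le)// -[leRHS]powRr1 ?ler0n//.
        apply: ler_powR => //.
        have := grid_r_le; have := grid_r_gt0; have : 2 <= d%:R :> R by rewrite d2.
        by move=> h1 h2; rewrite (_ : (d%:R : R) = 2) ?d2//; lra.
      rewrite -mulnn; nia.
    move: lN; rewrite !lnXn ?ltr0n// -[ln 2 *+ _]mulr_natl -[ln N.+1%:R *+ _]mulr_natl.
    have h := ln2_ge.
    have : 0 <= J%:R :> R by rewrite ler0n.
    nra.
  have -> : @rate R d N = N%:R `^ (- 4^-1) * ln N.+1%:R by rewrite /rate d2.
  rewrite JE.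
  have q4 : Num.sqrt (M%:R ^+ d / N%:R) <= N%:R `^ (- 4^-1) :> R.
    apply: (le_trans sqrt_cells_le); rewrite [r]/grid_r d2/=.
    by rewrite (_ : (2 * 2%:R)^-1 = 4^-1 :> R)//; congr _^-1; lra.
  apply: (@le_trans _ _ (N%:R `^ (- 4^-1) * (4 * ln N.+1%:R))).
    by apply: ler_pM => //; rewrite ler0n.
  have : 0 <= N%:R `^ (- 4^-1) * ln N.+1%:R :> R.
    by rewrite mulr_ge0 ?powR_ge0// ln_ge0// ler1n.
  lra.
Qed.

End Rates.

(** * The grid *)

Section Grid.
Context {R : realType} {d : nat} (m : nat).
Local Notation T := (Rd R d).
Local Notation M := (m.+1%:R : R).

Definition cell_rank (t : R) : int :=
  Order.max 0%R (Order.min (Num.floor (t * M)) (m.+1%:Z - 1)).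
Definition index1 (t : R) : 'I_m.+1 := inord `|cell_rank t|%N.
Definition mid1 (j : nat) : R := (j%:R + 2^-1) / M.

Definition grid := {ffun 'I_d -> 'I_m.+1}.
Definition cell_index (x : T) : grid := [ffun i => index1 (x ord0 i)].
Definition cell_center (s : grid) : T := \row_i mid1 (s i).

Let M0 : 0 < M. Proof. by rewrite ltr0n. Qed.

Lemma cell_rank_ge0 t : 0 <= cell_rank t.
Proof. by rewrite /cell_rank le_max lexx. Qed.

Lemma cell_rank_le t : cell_rank t <= m%:Z.
Proof. by rewrite /cell_rank ge_max ge_min; apply/andP; split=> //; lia. Qed.

Lemma index1E t : (index1 t : nat)%:Z = cell_rank t.
Proof.
have := cell_rank_ge0 t; have := cell_rank_le t => h1 h2.
rewrite /index1 inordK; first by rewrite gez0_abs.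
by move: h1 h2; case: (cell_rank t) => [n|n]; rewrite ?absz_nat; lia.
Qed.

Lemma center1E t : center1 m.+1 t = mid1 (index1 t).
Proof. by rewrite /center1 -/(cell_rank t) -index1E. Qed.

(** At thresholds strictly above 0 and at most m the clamping in [cell_rank] is invisible. Location
    and measurability of the cells are all read off from this equivalence. *)
Lemma le_index1 (j : nat) t : (0 < j <= m)%N -> (j <= index1 t)%N = (j%:R <= t * M).
Proof.
move=> jm; have -> : (j <= index1 t)%N = (j%:Z <= cell_rank t) by rewrite -index1E lez_nat.
rewrite /cell_rank le_max le_min floor_ge_int.
have -> : (j%:Z <= 0) = false by lia.
have -> : (j%:Z <= m.+1%:Z - 1) by lia.
by rewrite andbT.
Qed.

Lemma index1_mid j : (j <= m)%N -> index1 (mid1 j) = j :> nat.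
Proof.
move=> jm; apply/eqP; rewrite eqn_leq.
have jM : mid1 j * M = j%:R + 2^-1 by rewrite /mid1 divfK// gt_eqF.
apply/andP; split.
  rewrite leqNgt; apply/negP => h.
  have jm' : (0 < j.+1 <= m)%N by rewrite /= (leq_trans h) ?leq_ord.
  by move: h; rewrite le_index1// jM -natr1; lra.
by have [->//|j0] := posnP j; rewrite le_index1 ?j0// jM; lra.
Qed.

Lemma cell_index_center s : cell_index (cell_center s) = s.
Proof.
by apply/ffunP => i; apply/val_inj; rewrite ffunE mxE /= index1_mid// -ltnS.
Qed.

Lemma mid1_itv j : (j <= m)%N -> 0 <= mid1 j <= 1.
Proof.
move=> jm; have j0 : 0 <= j%:R :> R by rewrite ler0n.
apply/andP; split; first by rewrite divr_ge0//; lra.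
rewrite ler_pdivrMr// mul1r -[M]natr1; have : j%:R <= m%:R :> R by rewrite ler_nat.
lra.
Qed.

Lemma cube_center s : cube (cell_center s).
Proof. by move=> i; rewrite mxE mid1_itv// -ltnS. Qed.

Lemma mid1_index1 t : 0 <= t <= 1 -> `|t - mid1 (index1 t)| <= 2^-1 / M.
Proof.
move=> /andP[t0 t1].
have -> : t - mid1 (index1 t) = (t * M - ((index1 t)%:R + 2^-1)) / M.
  by rewrite /mid1; field; rewrite gt_eqF.
rewrite normrM [`|M^-1|]ger0_norm ?invr_ge0// ler_wpM2r ?invr_ge0//.
have tM0 : 0 <= t * M by rewrite mulr_ge0.
have tM1 : t * M <= m%:R + 1 by rewrite natr1 ler_piMl.
have lo : (index1 t)%:R <= t * M.
  have [->|j0] := posnP (index1 t); first exact: tM0.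
  by rewrite -le_index1 ?leqnn// j0/= -ltnS ltn_ord.
(* In the last cell, closed on the right, this bound comes from t <= 1; in the others from not
   reaching the next threshold. *)
have hi : t * M <= (index1 t)%:R + 1.
  have := ltn_ord (index1 t); rewrite ltnS leq_eqVlt => /predU1P[->//|lt].
  have := @le_index1 (index1 t).+1 t; rewrite /= lt ltnn => /(_ isT)/esym/negbT.
  by rewrite -ltNge -[(index1 t).+1%:R]natr1 => /ltW.
by rewrite ler_norml; lra.
Qed.

Lemma eucl_center_index (x : T) : cube x ->
  eucl x (cell_center (cell_index x)) <= Num.sqrt d%:R * (2^-1 / M).
Proof.
move=> cx; apply: eucl_le; first by rewrite divr_ge0.
by move=> i; rewrite mxE ffunE; exact: mid1_index1.
Qed.

Lemma dist_mid1 (a b : nat) : mid1 a - mid1 b = (a%:R - b%:R) / M.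
Proof. by rewrite /mid1; field; rewrite gt_eqF. Qed.

Lemma eucl_center_le (s t : grid) : eucl (cell_center s) (cell_center t) <= Num.sqrt d%:R.
Proof.
rewrite -[leRHS]mulr1; apply: eucl_le => // i; rewrite !mxE.
have hs : (s i <= m)%N by rewrite -ltnS.
have ht : (t i <= m)%N by rewrite -ltnS.
have := mid1_itv hs; have := mid1_itv ht; rewrite ler_norml; lra.
Qed.

Lemma measurable_cell_index s : measurable (cell_index @^-1` [set s]).
Proof.
have mge j : measurable [set t : R | (j <= index1 t)%N].
  have [->|j0] := posnP j; first by rewrite (_ : [set _ | _] = setT)//; apply/seteqP.
  have [jm|mj] := leqP j m; last first.
    rewrite (_ : [set _ | _] = set0)//; apply/seteqP; split=> t //=.
    by move=> h; have := ltn_ord (index1 t); rewrite ltnS leqNgt (leq_trans mj).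
  rewrite (_ : [set _ | _] = `[j%:R / M, +oo[%classic); first exact: measurable_itv.
  apply/seteqP; split=> t /=; rewrite in_itv/= andbT le_index1 ?j0// ler_pdivrMr//.
have meq (j : 'I_m.+1) : measurable [set t : R | index1 t = j].
  rewrite (_ : [set _ | _] = [set t | (j <= index1 t)%N] `\` [set t | (j < index1 t)%N]).
    exact: measurableD.
  apply/seteqP; split=> t /=; first by move=> ->; rewrite ltnn leqnn.
  by move=> [h1 /negP]; rewrite -leqNgt => h2; apply/val_inj/eqP; rewrite eqn_leq h2.
have -> : cell_index @^-1` [set s] =
    \bigcap_(i in [set: 'I_d]) ((fun x : T => x ord0 i) @^-1` [set t | index1 t = s i]).
  apply/seteqP; split=> x /=; first by move=> <- i _ /=; rewrite ffunE.
  by move=> h; apply/ffunP => i; rewrite ffunE; exact: h.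
apply: fin_bigcap_measurable => [|i _]; first exact: finite_finset.
by rewrite -[X in measurable X]setTI; apply: measurable_coord.
Qed.

(** Rounding down keeps the representatives inside the grid even when [m.+1] is not a power of 2. *)
Definition coarsen (l : nat) (s : grid) : grid :=
  [ffun i => inord (s i %/ 2 ^ l * 2 ^ l)].

Lemma coarsenE l s i : coarsen l s i = (s i %/ 2 ^ l * 2 ^ l)%N :> nat.
Proof. by rewrite ffunE inordK// (leq_ltn_trans (leq_trunc_div _ _)). Qed.

Lemma coarsen0 s : coarsen 0 s = s.
Proof. by apply/ffunP => i; apply/val_inj; rewrite /= coarsenE expn0 divn1 muln1. Qed.

Lemma coarsenS l s : coarsen l.+1 (coarsen l s) = coarsen l.+1 s.
Proof.
apply/ffunP => i; apply/val_inj; rewrite /= !coarsenE; congr (_ * _)%N.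
by rewrite expnSr !divnMA mulnK// expn_gt0.
Qed.

Lemma coarsen_top s t : coarsen (up_log 2 m.+1) s = coarsen (up_log 2 m.+1) t.
Proof.
have h := up_logP m.+1 (isT : (1 < 2)%N).
apply/ffunP => i; apply/val_inj; rewrite /= !coarsenE.
by rewrite !divn_small ?(leq_trans (ltn_ord _) h).
Qed.

Lemma coarsen_dist l s :
  eucl (cell_center (coarsen l s)) (cell_center (coarsen l.+1 s)) <=
  Num.sqrt d%:R * (2 ^+ l / M).
Proof.
apply: eucl_le => [|i]; first by rewrite divr_ge0// exprn_ge0.
rewrite !mxE dist_mid1 !coarsenE normrM [`|M^-1|]ger0_norm ?invr_ge0//.
rewrite ler_wpM2r ?invr_ge0// expnSr divnMA; set a := (s i %/ 2 ^ l)%N.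
rewrite {1}(divn_eq a 2) !natrM natrD natrM natrX.
(* Two successive roundings differ by the binary digit of weight 2^l of the index. *)
have -> : ((a %/ 2)%:R * 2 + (a %% 2)%:R) * 2 ^+ l - (a %/ 2)%:R * (2 ^+ l * 2) =
   (a %% 2)%:R * 2 ^+ l :> R by ring.
rewrite normrM !ger0_norm ?exprn_ge0// ler_piMl ?exprn_ge0//.
by rewrite lern1 -ltnS ltn_mod.
Qed.

(** The factor 2 per axis absorbs the incomplete last block, as M / 2^l >= 1. *)
Lemma card_level l : (2 ^ l <= m.+1)%N ->
  (#|level coarsen l|%:R : R) <= (2 * (M / 2 ^+ l)) ^+ d.
Proof.
move=> lm; have p0 : (0 < 2 ^ l)%N by rewrite expn_gt0.
pose K := (m %/ 2 ^ l).+1.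
pose G (f : {ffun 'I_d -> 'I_K}) : grid := [ffun i => inord (f i * 2 ^ l)].
have sub : level coarsen l \subset (G @: finset.setT).
  apply/fintype.subsetP => _ /imsetP[s _ ->]; apply/imsetP.
  exists [ffun i => inord (s i %/ 2 ^ l)]; rewrite ?finset.in_setT//; apply/ffunP => i; rewrite !ffunE.
  by congr inord; rewrite inordK// ltnS leq_div2r// -ltnS.
have : (#|level coarsen l| <= K ^ d)%N.
  rewrite (leq_trans (subset_leq_card sub))// (leq_trans (leq_imset_card _ _))//.
  by rewrite finset.cardsT card_ffun !card_ord.
rewrite -(ler_nat R) natrX => /le_trans; apply.
have p2 : 0 < 2 ^+ l :> R by rewrite exprn_gt0.
rewrite lerXn2r ?nnegrE ?mulr_ge0 ?divr_ge0 ?(ltW p2)//.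
have h1 : (m %/ 2 ^ l)%:R <= M / 2 ^+ l.
  rewrite ler_pdivlMr// -natrX -natrM ler_nat (leq_trans (leq_trunc_div _ _))//.
have h2 : 1 <= M / 2 ^+ l by rewrite ler_pdivlMr// mul1r -natrX ler_nat.
rewrite /K -[(m %/ 2 ^ l).+1%:R]natr1; lra.
Qed.

Lemma card_grid : #|{: grid}| = (m.+1 ^ d)%N.
Proof. by rewrite card_ffun !card_ord. Qed.

End Grid.

Section ExpectedDeviation.
Context {R : realType} {d N m : nat}.
Hypothesis d_gt0 : (0 < d)%N.
Hypothesis N_gt0 : (0 < N)%N.
Hypothesis cellsE : @cells R d N = m.+1.
Context (w : grid (d := d) m * grid (d := d) m -> R).
Hypothesis w_ge0 : forall p, 0 <= w p.
Hypothesis w_sum : \sum_p w p = 1.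

Local Notation dist := (fun s t => eucl (cell_center (R := R) s) (cell_center t)).

(** 32 is 2 times the 16 of [scale_sum_le], the root of 2^d comes from [card_level], and 6 is 3
    times the 2 of [powR_rate_le]; sqrt d is the diameter of the cube. *)
Definition rate_constant : R := Num.sqrt d%:R * (32 * Num.sqrt (2 ^+ d) + 6).

Lemma Ex_deviation_rate :
  Ex w N (deviation dist (Num.sqrt d%:R) w) <= rate_constant * @rate R d N.
Proof.
have M0 : 0 < m.+1%:R :> R by rewrite ltr0n.
have B0 : 0 < Num.sqrt d%:R :> R by rewrite sqrtr_gt0 ltr0n.
have p2 l : 0 < 2 ^+ l :> R by rewrite exprn_gt0.
apply: le_trans (Ex_deviation (J := up_log 2 m.+1) (rho := @coarsen d m)
  (delta := fun l => Num.sqrt d%:R * (2 ^+ l / m.+1%:R)) _ B0 _ w_ge0 w_sum _ _ _ _ _ N_gt0) _.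
- by move=> *; exact: eucl_ge0.
- by move=> *; exact: euclC.
- exact: coarsen0.
- exact: coarsenS.
- exact: coarsen_top.
- by move=> l s _; exact: coarsen_dist.
- by move=> l; rewrite mulr_ge0 ?sqrtr_ge0// divr_ge0 ?ltW.
have q1 := sqrt_cells_le d_gt0 N_gt0 (R := R); have q2 := scale_sum_le d_gt0 N_gt0 (R := R).
have q3 := powR_rate_le d_gt0 N_gt0 (R := R).
move: q1 q2; rewrite /scale_sum cellsE => q1 q2.
set q := Num.sqrt (_ / _) in q1 q2.
have qE : Num.sqrt (#|{: grid (d := d) m}|%:R / N%:R) = q by rewrite card_grid natrX.
have q0 : 0 <= q by exact: sqrtr_ge0.
have hsum : \sum_(l < up_log 2 m.+1) Num.sqrt d%:R * (2 ^+ l / m.+1%:R) *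
    Num.sqrt ((#|{: grid (d := d) m}| * #|level (@coarsen d m) l|)%:R / N%:R) <=
    Num.sqrt d%:R * Num.sqrt (2 ^+ d) * (q * \sum_(l < up_log 2 m.+1) 2 ^+ l / m.+1%:R *
      Num.sqrt ((m.+1%:R / 2 ^+ l) ^+ d)).
  rewrite !mulr_sumr; apply: ler_sum => l _.
  have ll : (2 ^ l <= m.+1)%N.
    rewrite leqNgt; apply/negP => /ltnW h.
    by have := up_log_min (isT : (1 < 2)%N) h; rewrite leqNgt ltn_ord.
  apply: (@le_trans _ _ (Num.sqrt d%:R * (2 ^+ l / m.+1%:R) *
     (q * Num.sqrt ((2 * (m.+1%:R / 2 ^+ l)) ^+ d)))).
    rewrite ler_wpM2l ?mulr_ge0 ?sqrtr_ge0 ?divr_ge0 ?(ltW (p2 _))//.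
    rewrite natrM mulrAC sqrtrM ?divr_ge0 ?ler0n// qE ler_wpM2l//.
    by rewrite ler_wsqrtr// card_level.
  rewrite exprMn sqrtrM ?exprn_ge0// le_eqVlt; apply/orP; left; apply/eqP.
  ring.
rewrite qE; apply: (le_trans (lerD (ler_wpM2l _ hsum) (lexx _))) => //.
have k1 := ler_wpM2l (mulr_ge0 (sqrtr_ge0 (d%:R : R)) (sqrtr_ge0 (2 ^+ d : R))) q2.
have k2 := ler_wpM2l (sqrtr_ge0 (d%:R : R)) (le_trans q1 q3).
rewrite /rate_constant; lra.
Qed.

End ExpectedDeviation.

(** * Bias *)

(* No measurability is required: the integral of a nonnegative function is the
   supremum of the integrals of the simple functions below it. *)
Lemma le_integral_nonmeasurable {R : realType} d (X : measurableType d)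
    (mu : {measure set X -> \bar R}) (f g : X -> \bar R) :
  (forall x, 0 <= f x)%E -> (forall x, f x <= g x)%E ->
  (\int[mu]_x f x <= \int[mu]_x g x)%E.
Proof.
move=> f0 fg; rewrite !ge0_integralTE//; last by move=> x; exact: le_trans (fg x).
apply: le_ereal_sup => _ [u /= uf <-]; exists u => // x.
exact: le_trans (fg x).
Qed.

Section Sandwich.
Context {R : realType} {dX : measure_display} {X : measurableType dX} {S : finType}.
Context (i : X -> S) (mu : probability X R).
Hypothesis mi : forall s, measurable (i @^-1` [set s]).
Local Notation mass s := (fine (mu (i @^-1` [set s]))).

(** [f] is squeezed between functions that are constant on cells inside a set of full measure and
    take the values 0 and infinity outside it. Bounds on [f] are thus required only on good points
    of cells with positive mass. *)
Lemma integral_sandwich (G : set X) (f : X -> \bar R) (lo hi : S -> R) :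
  measurable G -> mu (~` G) = 0%E -> (forall x, 0 <= f x)%E ->
  (forall s, 0 <= hi s)%R ->
  (forall x, G x -> (0 < mass (i x))%R -> (lo (i x))%:E <= f x <= (hi (i x))%:E)%E ->
  ((\sum_s lo s * mass s)%:E <= \int[mu]_x f x <= (\sum_s hi s * mass s)%:E)%E.
Proof.
move=> mG muG f0 hi0 fG.
pose pos := [set s | 0 < mass s].
have mpos P : measurable (i @^-1` P) by exact: measurable_finite_preimage.
pose G' := G `&` i @^-1` pos.
have mG' : measurable G' by exact: measurableI.
have mupos : mu (i @^-1` (~` pos)) = 0%E.
  rewrite -(sum_measure_cells mi)// big1// => s _.
  have [ps|ps] := pselect (pos s).
    rewrite (_ : _ `&` _ = set0) ?measure0//; apply/seteqP; split=> x //= [nx xs].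
    by apply: nx; rewrite /= xs.
  apply/eqP; rewrite -measure_le0.
  apply: (@le_trans _ _ (mu (i @^-1` [set s]))).
    apply: le_measure; rewrite ?inE; [|exact: mi|exact: subIsetr].
    by apply: measurableI => //; exact: mpos.
  have : mass s <= 0 by rewrite leNgt; apply/negP.
  by rewrite -lee_fin fineK// fin_num_measure.
have muG' : mu (~` G') = 0%E.
  rewrite /G' setCI measureU0//; first exact: measurableC.
  by rewrite preimage_setC in mupos; apply: measurableC.
(* Refining the partition by [G'] makes the truncated step functions factor through a finite map,
   hence measurable. *)
pose j x := (i x, x \in G').
have mj p : measurable (j @^-1` [set p]).
  case: p => s [].
    rewrite (_ : _ @^-1` _ = i @^-1` [set s] `&` G'); first exact: measurableI.
    apply/seteqP; split=> x /=; rewrite /j; first by move=> [-> /set_mem].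
    by move=> [-> /mem_set ->].
  rewrite (_ : _ @^-1` _ = i @^-1` [set s] `&` ~` G').
    by apply: measurableI => //; exact: measurableC.
  apply/seteqP; split=> x /=; rewrite /j.
    by move=> [-> /negbT/negP h]; split=> // /mem_set.
  by move=> [-> h]; rewrite (memNset h).
have ae_G' (v : S -> R) y : (forall s, 0 <= v s) -> (0 <= y)%E ->
    (\int[mu]_x (if x \in G' then (v (i x))%:E else y) = (\sum_s v s * mass s)%:E)%E.
  move=> v0 y0.
  transitivity (\int[mu]_x (v (i x))%:E)%E.
    apply: ge0_ae_eq_integral => //.
    - exact: (measurable_fun_finite mj (fun p => if p.2 then (v p.1)%:E else y)).
    - apply/measurable_EFinP; exact: (measurable_fun_finite mi).
    - by move=> x _; case: ifP; rewrite ?lee_fin.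
    - by move=> x _; rewrite lee_fin.
    exists (~` G'); split=> //; first exact: measurableC.
    by move=> x /= h G'x; apply: h; rewrite mem_set.
  rewrite (ge0_integral_finite mi)// -sumEFin; apply: eq_bigr => s _.
  by rewrite EFinM fineK// fin_num_measure.
apply/andP; split.
  (* [lo] may be negative; since f >= 0 it can be replaced by its positive part. *)
  apply: (@le_trans _ _ (\sum_s Num.max 0 (lo s) * mass s)%:E).
    rewrite lee_fin; apply: ler_sum => s _; rewrite ler_wpM2r ?fine_ge0//.
    by rewrite le_max lexx orbT.
  rewrite -(ae_G' _ 0%E)//; last by move=> s; rewrite le_max lexx.
  apply: le_integral_nonmeasurable => x.
    by case: ifP => // _; rewrite lee_fin le_max lexx.
  case: ifPn => // /set_mem [Gx px]; have /andP[lox _] := fG _ Gx px.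
  by rewrite EFin_max ge_max f0.
rewrite -(ae_G' hi +oo%E)//; apply: le_integral_nonmeasurable => // x.
case: ifPn => [/set_mem[Gx px]|_]; last by rewrite leey.
by have /andP[] := fG _ Gx px.
Qed.

End Sandwich.

Lemma W1_ge0 {R : realType} {d : nat} (alpha beta : set (Rd R d) -> \bar R) :
  (0 <= W1 alpha beta)%E.
Proof.
apply: le_ereal_inf_tmp => _ [g _ <-].
by apply: integral_ge0 => z _; rewrite lee_fin eucl_ge0.
Qed.

Section Bias.
Context {R : realType} {d : nat} {S : finType}.
Local Notation T := (Rd R d).
Context (i : T -> S) (c : S -> T) (h B : R).
Hypothesis mi : forall s, measurable (i @^-1` [set s]).
Hypothesis h_ge0 : 0 <= h.
Hypothesis ih : forall x, cube x -> eucl x (c (i x)) <= h.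
Hypothesis B_gt0 : 0 < B.
Hypothesis dist_B : forall s t, eucl (c s) (c t) <= B.
Local Notation dist := (center_dist c).
Local Notation kr := (kr dist B).
Context (pi : probability (T * T)%type R) (mu nu : probability T R).
Hypothesis pi_cube : pi (cube `*` cube) = 1%E.
Hypothesis mu_marg : forall A, measurable A -> mu A = pi (A `*` setT).
Hypothesis nu_marg : forall A, measurable A -> nu A = pi (setT `*` A).
Context (k : R.-pker T ~> T) (L : R).
Hypothesis k_dis : disintegration pi mu k.
Hypothesis k_lip : forall x y : T, cube x -> cube y ->
  (W1 (k x) (k y) <= (L * eucl x y)%:E)%E.

Let mcube : measurable (@cube R d) := measurable_cube.

Definition cell_law (p : S * S) : R :=
  fine (pi ((i @^-1` [set p.1]) `*` (i @^-1` [set p.2]))).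
Local Notation W := (fun s t => cell_law (s, t)).
Local Notation mass s := (fine (mu (i @^-1` [set s]))).

Lemma mu_cube : mu cube = 1%E.
Proof.
apply/eqP; rewrite eq_le probability_le1//= mu_marg// -pi_cube.
apply: le_measure; rewrite ?inE; [exact: measurableX|exact: measurableX|].
by move=> z [].
Qed.

Lemma nu_cube : nu cube = 1%E.
Proof.
apply/eqP; rewrite eq_le probability_le1//= nu_marg// -pi_cube.
apply: le_measure; rewrite ?inE; [exact: measurableX|exact: measurableX|].
by move=> z [].
Qed.

Lemma cell_law_ge0 p : 0 <= cell_law p.
Proof. exact: fine_ge0. Qed.

Lemma marg1_cell_law s : marg1 W s = mass s.
Proof.
have m2 t : measurable ((fun z : T * T => i z.2) @^-1` [set t]).
  by rewrite -[X in measurable X]setTI; exact: (measurable_snd measurableT _ (mi t)).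
have mA : measurable ((i @^-1` [set s]) `*` [set: T]) by exact: measurableX.
apply: EFin_inj; rewrite [RHS]fineK ?fin_num_measure// mu_marg// -(sum_fine_cells m2)//.
congr (_%:E); apply: eq_bigr => t _; rewrite /cell_law; congr (fine (pi _)).
by apply/seteqP; split=> z /=; [case=> -> ->|case=> -[-> _] ->].
Qed.

Lemma marg2_cell_law t : marg2 W t = fine (nu (i @^-1` [set t])).
Proof.
have m1 s : measurable ((fun z : T * T => i z.1) @^-1` [set s]).
  by rewrite -[X in measurable X]setTI; exact: (measurable_fst measurableT _ (mi s)).
have mA : measurable ([set: T] `*` (i @^-1` [set t])) by exact: measurableX.
apply: EFin_inj; rewrite [RHS]fineK ?fin_num_measure// nu_marg// -(sum_fine_cells m1)//.
congr (_%:E); apply: eq_bigr => s _; rewrite /cell_law; congr (fine (pi _)).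
by apply/seteqP; split=> z /=; [case=> -> ->|case=> -[_ ->] ->].
Qed.

Lemma cell_law_sum : \sum_p cell_law p = 1.
Proof.
rewrite -[RHS](sum_cell_mass mi mu).
transitivity (\sum_p cell_law (p.1, p.2)); first by apply: eq_bigr => -[].
rewrite -(pair_bigA _ (fun s t => cell_law (s, t)))/=.
by apply: eq_bigr => s _; exact: marg1_cell_law.
Qed.

(** The kernel is a law on the cube only for [mu]-almost every point, while the discretization of
    [W1] needs it at each point used. *)
Let good : set T := cube `&` (fun x => k x (~` cube)) @^-1` [set 0%E].

Let mgood : measurable good.
Proof.
apply: measurableI => //; rewrite -[X in measurable X]setTI.
by apply: (measurable_kernel k _ (measurableC mcube)).
Qed.

Let mu_good : mu (~` good) = 0%E.
Proof.
have : {ae mu, forall x, k x (~` cube) = 0%E}.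
  have mk : measurable_fun setT (fun x => k x (~` cube)).
    exact: (measurable_kernel k _ (measurableC mcube)).
  (* By disintegration this integral is the [nu]-mass of the complement of the cube. *)
  have : (\int[mu]_x `|k x (~` cube)| = 0)%E.
    under eq_integral do rewrite gee0_abs//.
    rewrite -k_dis//; last exact: measurableC.
    rewrite -nu_marg; last exact: measurableC.
    by rewrite probability_setC// nu_cube subee.
  move=> /(ae_eq_integral_abs mu measurableT mk).
  by apply: filterS => x; exact.
move=> [Z [mZ Z0 hZ]]; apply/eqP; rewrite -measure_le0.
have mu0 : mu (~` @cube R d) = 0%E by rewrite probability_setC// mu_cube subee.
have -> : (0 = mu (~` cube `|` Z))%E.
  apply/esym; apply: etrans mu0; apply: measureU0 => //; exact: measurableC.
apply: le_measure; rewrite ?inE; [exact: measurableC|apply: measurableU => //; exact: measurableC|].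
rewrite /good setCI => x [|nx]; [by left|right].
exact: hZ.
Qed.

Let k_cube x : good x -> k x cube = 1%E.
Proof.
move=> [_ kx]; have kx0 : k x (~` @cube R d) = 0%E := kx.
apply: etrans (prob_kernel (s := k) x); rewrite -(setUv (@cube R d)).
by apply/esym; apply: measureU0 => //; exact: measurableC.
Qed.

(** Oscillation of the discretized kernel within a cell: the Lipschitz bound at distance 2 h, plus
    the discretization error of [W1]. *)
Let E : R := 2 * `|L| * h + 2 * h.
Let s0 : S := i 0.

Let cell_diam x y : cube x -> cube y -> i x = i y -> eucl x y <= 2 * h.
Proof.
move=> /ih hx /ih hy xy; have := eucl_tri x (c (i x)) y.
by rewrite {2}xy [eucl (c (i y)) y]euclC; lra.
Qed.

Let kernel_close x y (v : S -> R) : good x -> good y -> i x = i y ->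
  potential dist B v ->
  \sum_t v t * (fine (k x (i @^-1` [set t])) - fine (k y (i @^-1` [set t]))) <= E.
Proof.
move=> gx gy xy hv; apply: (le_trans (le_kr _ hv)).
have [r Wr hr] := W1_approx s0 mi h_ge0 ih dist_B (prob_kernel x) (prob_kernel y)
  (k_cube gx) (k_cube gy).
have := k_lip gx.1 gy.1; rewrite Wr lee_fin => hL.
have : L * eucl x y <= `|L| * (2 * h).
  apply: (@le_trans _ _ (`|L| * eucl x y)).
    by rewrite ler_wpM2r ?eucl_ge0// ler_norm.
  by rewrite ler_wpM2l// cell_diam//; [exact: gx.1|exact: gy.1].
by move: hr; rewrite ler_norml /E; lra.
Qed.

Let k_fin y t : k y (i @^-1` [set t]) \is a fin_num.
Proof.
have [p pE] := probability_of_measure (prob_kernel (s := k) y).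
by rewrite -pE fin_num_measure.
Qed.

Let k_sum y : \sum_t fine (k y (i @^-1` [set t])) = 1.
Proof.
have [p pE] := probability_of_measure (prob_kernel (s := k) y).
by rewrite -pE; exact: sum_cell_mass.
Qed.

Let B_ge0 : 0 <= B. Proof. exact: ltW. Qed.

(** The row of the joint law is the integral of k y over y in the cell of x, so integrating
    [kernel_close] in y compares it with the cell mass times k x. The shift by [B] again makes the
    integrands nonnegative. *)
Let cell_kernel_close x (u : S -> R) : good x -> potential dist B u ->
  \sum_t u t * (mass (i x) * fine (k x (i @^-1` [set t])) - W (i x) t) <=
  mass (i x) * E.
Proof.
move=> gx hu; set s := i x.
have mQ t : measurable (i @^-1` [set t]) by exact: mi.
pose v t := u t + B.
have v0 t : 0 <= v t by have := hu.2 t; rewrite /v ler_norml; lra.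
have E0 : 0 <= E by rewrite /E addr_ge0 ?mulr_ge0.
have vE (F : S -> R) : \sum_t v t * F t = \sum_t u t * F t + B * \sum_t F t.
  by rewrite mulr_sumr -big_split; apply: eq_bigr => t _; rewrite /v mulrDl.
pose Kx := \sum_t v t * fine (k x (i @^-1` [set t])).
have Kx0 : 0 <= Kx by apply: sumr_ge0 => t _; rewrite mulr_ge0 ?fine_ge0.
have mk t : measurable_fun (i @^-1` [set s]) (fun y => k y (i @^-1` [set t])).
  by apply: measurable_funTS; exact: (measurable_kernel k _ (mQ t)).
have mvk t : measurable_fun (i @^-1` [set s]) (fun y => (v t)%:E * k y (i @^-1` [set t]))%E.
  exact: measurable_funeM.
have h1 : (\int[mu]_(y in i @^-1` [set s]) Kx%:E <=
    \int[mu]_(y in i @^-1` [set s]) (\sum_t (v t)%:E * k y (i @^-1` [set t]) + E%:E))%E.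
  apply: ae_ge0_le_integral => //.
  - move=> y _; rewrite adde_ge0 ?lee_fin// sume_ge0// => t _.
    by rewrite mule_ge0 ?lee_fin.
  - by apply: emeasurable_funD => //; exact: emeasurable_sum.
  exists (~` good); split => //; first exact: measurableC.
  move=> y /= ny gy; apply: ny => /= ys.
  under eq_bigr do rewrite -[k y _]fineK//.
  rewrite sumEFin -EFinD lee_fin.
  have := kernel_close gx gy (esym ys) hu.
  under eq_bigr do rewrite mulrBr.
  by rewrite sumrB /Kx !vE !k_sum; lra.
rewrite integral_cst// ge0_integralD// in h1; last 2 first.
- by move=> y _; rewrite sume_ge0// => t _; rewrite mule_ge0 ?lee_fin.
- exact: emeasurable_sum.
rewrite integral_cst// ge0_integral_sum// in h1; last first.
  by move=> t y _; rewrite mule_ge0 ?lee_fin.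
have e1 : (\sum_t \int[mu]_(y in i @^-1` [set s]) ((v t)%:E * k y (i @^-1` [set t])) =
    (\sum_t v t * W s t)%:E)%E.
  rewrite -sumEFin; apply: eq_bigr => t _.
  rewrite ge0_integralZl//; last by rewrite lee_fin.
  rewrite -k_dis// EFinM /cell_law fineK// fin_num_measure//.
  exact: measurableX.
rewrite e1 -[X in (_ * X <= _)%E]fineK ?fin_num_measure// in h1.
rewrite -[X in (_ <= _ + _ * X)%E]fineK ?fin_num_measure// in h1.
rewrite -!EFinM -EFinD lee_fin /Kx !vE k_sum in h1.
have := marg1_cell_law s; rewrite /marg1 => mW; rewrite mW in h1.
under eq_bigr do rewrite mulrBr mulrCA.
rewrite sumrB -mulr_sumr; lra.
Qed.

(** The approximating value depends on x only through its cell; this is what [integral_sandwich]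
    needs. *)
Let W1_kernel_cell x : good x -> 0 < mass (i x) ->
  exists2 r, W1 (k x) nu = r%:E &
    `|r - kr (fun t => W (i x) t - marg1 W (i x) * marg2 W t) / mass (i x)| <= E + 2 * h.
Proof.
move=> gx mx.
have [r Wr hr] := W1_approx s0 mi h_ge0 ih dist_B (prob_kernel (s := k) x)
  (probability_setT nu)
  (k_cube gx) nu_cube.
exists r => //; set kf := kr _ in hr; set kg := kr _.
have dC s t : dist s t = dist t s by exact: euclC.
have d0 s t : 0 <= dist s t by exact: eucl_ge0.
have key : `|mass (i x) * kf - kg| <= mass (i x) * E.
  rewrite /kf -krZ//; last exact: ltW.
  apply: (le_trans (kr_dist d0 B_ge0 dC _ _)).
  apply: kr_le => // u hu; apply: le_trans (cell_kernel_close gx hu).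
  rewrite le_eqVlt; apply/orP; left; apply/eqP; apply: eq_bigr => t _.
  by rewrite marg1_cell_law marg2_cell_law; ring.
have : `|kf - kg / mass (i x)| <= E.
  rewrite -(ler_pM2l mx); apply: le_trans key.
  rewrite -[X in X * `|_|](ger0_norm (ltW mx)) -normrM mulrBr mulrCA mulfV ?gt_eqF// mulr1.
  exact: lexx.
by move: hr; rewrite !ler_norml; lra.
Qed.

Theorem dependence_bias :
  exists2 r, (\int[mu]_x W1 (k x) nu = r%:E)%E &
    `|r - dependence dist B W| <= (2 * `|L| + 4) * h.
Proof.
pose a s := kr (fun t => W s t - marg1 W s * marg2 W t) / mass s.
have dep : dependence dist B W = \sum_s a s * mass s.
  (* For a null cell the quotient [a s] is 0 by convention, and the row vanishes, so its term in
     [dependence] is 0 too. *)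
  apply: eq_bigr => s _; rewrite /a; have [m0|m0] := eqVneq (mass s) 0; last by rewrite divfK.
  have d0 s' t : 0 <= dist s' t by exact: eucl_ge0.
  rewrite m0 mulr0; apply/eqP; rewrite eq_le (kr_ge0 d0 B_ge0) andbT.
  have W0 t : W s t = 0.
    have := marg1_cell_law s; rewrite m0 => /eqP; rewrite psumr_eq0 => [/allP/(_ t)|t' _].
      by rewrite mem_index_enum => /(_ isT)/eqP.
    exact: cell_law_ge0.
  have -> : marg1 W s = 0 by rewrite marg1_cell_law.
  apply: kr_le => // u _.
  by rewrite big1// => t _; rewrite W0 mul0r subrr mulr0.
have E'0 : 0 <= E + 2 * h by rewrite /E !addr_ge0 ?mulr_ge0.
have mass_sum : \sum_s mass s = 1 by exact: sum_cell_mass.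
have /andP[lo hi] : ((dependence dist B W - (E + 2 * h))%:E <= \int[mu]_x W1 (k x) nu
    <= (dependence dist B W + (E + 2 * h))%:E)%E.
  have -> : dependence dist B W - (E + 2 * h) = \sum_s (a s - (E + 2 * h)) * mass s.
    under eq_bigr do rewrite mulrBl.
    by rewrite sumrB -mulr_sumr mass_sum mulr1 dep.
  have -> : dependence dist B W + (E + 2 * h) = \sum_s (a s + (E + 2 * h)) * mass s.
    under eq_bigr do rewrite mulrDl.
    by rewrite big_split/= -mulr_sumr mass_sum mulr1 dep.
  apply: (integral_sandwich mi mgood mu_good) => [x|s|x gx mx]; first exact: W1_ge0.
    rewrite addr_ge0// divr_ge0 ?fine_ge0//; apply: kr_ge0 => // *; exact: eucl_ge0.
  have [r -> hr] := W1_kernel_cell gx mx; rewrite !lee_fin.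
  by move: hr; rewrite ler_norml /a; lra.
have -> : (2 * `|L| + 4) * h = E + 2 * h by rewrite /E; ring.
move: lo hi; case: (\int[mu]_x _)%E => [r| |].
- by rewrite !lee_fin => lo hi; exists r => //; rewrite ler_norml; apply/andP; split; lra.
- by move=> _; rewrite leye_eq.
- by rewrite leeNy_eq.
Qed.

End Bias.

(** * Empirical measures *)

Section EmpiricalMeasure.
Context {R : realType} {d : nat} (N : nat).
Local Notation T := (Rd R d).
Implicit Types (p : nat -> T) (A : set T).
Hypothesis N_gt0 : (0 < N)%N.

Lemma measurable_point (x : T) : measurable [set x].
Proof.
have -> : [set x] = \bigcap_(i in [set: 'I_d]) ((fun y : T => y ord0 i) @^-1` [set x ord0 i]).
  apply/seteqP; split=> y /=; first by move=> -> i _.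
  by move=> h; apply/rowP => i; exact: h.
apply: fin_bigcap_measurable => [|i _]; first exact: finite_finset.
by rewrite -[X in measurable X]setTI; apply: measurable_coord.
Qed.

Lemma empiricalE p A :
  empirical N p A = (N%:R^-1 * \sum_(n < N) (p n \in A)%:R)%:E.
Proof. by rewrite EFinM -sumEFin. Qed.

Lemma emp_condE p1 p2 x A :
  emp_cond N p1 p2 x A = ((\sum_(n < N) ((p1 n : 'rV[R]_d) == x))%:R^-1 *
    \sum_(n < N) ((p1 n : 'rV[R]_d) == x)%:R * (p2 n \in A)%:R)%:E.
Proof.
rewrite EFinM -sumEFin; congr (_ * _)%E; apply: eq_bigr => n _.
by case: eqP => _; rewrite ?mul1r ?mul0r// diracE.
Qed.

Lemma integral_empirical p (f : T -> \bar R) : measurable_fun setT f ->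
  (forall x, 0 <= f x)%E ->
  (\int[empirical N p]_x f x = (N%:R^-1)%:E * \sum_(n < N) f (p n))%E.
Proof.
move=> mf f0; rewrite /empirical ge0_integral_mscale//; congr (_ * _)%E.
rewrite ge0_integral_measure_sum//; apply: eq_bigr => n _.
by rewrite integral_dirac// diracT mul1e.
Qed.

Context {S : finType} (i : T -> S) (c : S -> T).
Hypothesis mi : forall s, measurable (i @^-1` [set s]).
Hypothesis ic : forall s, i (c s) = s.

(** The function takes finitely many values: off the centers no sample matches x and the conditional
    measure is zero, so it factors through the map that recognizes centers. *)
Lemma measurable_W1_emp_cond (y : nat -> S * S) (nu : set T -> \bar R) :
  measurable_fun setT
    (fun x => W1 (emp_cond N (fun n => c (y n).1) (fun n => c (y n).2) x) nu).
Proof.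
set g := fun x => _.
pose j x := if (x : 'rV[R]_d) == c (i x) then Some (i x) else None.
pose v o := if o is Some s then g (c s) else W1 (fun=> 0%E) nu.
have -> : g = v \o j.
  apply/funext => x; rewrite /= /v /j; case: eqP => [{1}->//|xc].
  rewrite /g; congr W1; apply/funext => A; rewrite emp_condE.
  rewrite [X in _ * X]big1 ?mulr0// => n _; case: eqP => [nx|]; last by rewrite mul0r.
  by exfalso; apply: xc; rewrite -nx ic.
apply: measurable_fun_finite => -[s|].
  rewrite (_ : _ @^-1` _ = [set c s]); first exact: measurable_point.
  apply/seteqP; split=> x /=; rewrite /j; first by case: eqP => // xc [<-].
  by move=> ->; rewrite ic eqxx.
rewrite (_ : _ @^-1` _ = ~` (\bigcup_(s in [set: S]) [set c s])).
  apply: measurableC; apply: fin_bigcup_measurable => [|s _]; first exact: finite_finset.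
  exact: measurable_point.
apply/seteqP; split=> x /=; rewrite /j.
  by case: eqP => // xc _ [s _ /= xs]; apply: xc; rewrite xs ic.
by case: eqP => // xc h; exfalso; apply: h; exists (i x).
Qed.

Context (h B : R).
Hypothesis c_cube : forall s, cube (c s).
Hypothesis h_ge0 : 0 <= h.
Hypothesis ih : forall x, cube x -> eucl x (c (i x)) <= h.
Hypothesis B_gt0 : 0 < B.
Hypothesis dist_B : forall s t, eucl (c s) (c t) <= B.
Local Notation dist := (center_dist c).

(** The empirical integral in terms of cell pairs alone, so that it can be evaluated on the finite
    sequences of [Ex]. *)
Definition plug_in (y : nat -> S * S) : \bar R :=
  ((N%:R^-1)%:E * \sum_(n < N)
    W1 (emp_cond N (fun n => c (y n).1) (fun n => c (y n).2) (c (y n).1))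
       (empirical N (fun n => c (y n).2)))%E.

Let freqE {K : finType} (kappa : S * S -> K) (y : nat -> S * S) k :
  freq kappa (mkseq y N) k = N%:R^-1 * \sum_(n < N) (kappa (y n) == k)%:R :> R.
Proof.
rewrite /freq size_mkseq big_map.
by rewrite (_ : iota 0 N = index_iota 0 N) ?big_mkord// /index_iota subn0.
Qed.

Lemma eq_plug_in (y y' : nat -> S * S) : (forall n, (n < N)%N -> y n = y' n) ->
  plug_in y = plug_in y'.
Proof.
move=> yy'; congr (_ * _)%E; apply: eq_bigr => n _; rewrite yy'//.
congr W1; apply/funext => A.
  rewrite !emp_condE; congr (_%:R^-1 * _)%:E; apply: eq_bigr => n' _; rewrite yy'//.
by rewrite !empiricalE; congr (_ * _)%:E; apply: eq_bigr => n' _; rewrite yy'.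
Qed.

(** Grouping the samples by their first cell s gives the weight [cnt s] / N, which [krZ] moves
    inside [kr], where it cancels the denominator of the conditional law. *)
Lemma plug_in_dependence (y : nat -> S * S) :
  exists2 r, plug_in y = r%:E &
    `|r - dependence dist B (empirical_joint (mkseq y N))| <= 2 * h.
Proof.
have NR : 0 < N%:R :> R by rewrite ltr0n.
set p1 := fun n => c (y n).1; set p2 := fun n => c (y n).2.
have c_inj s t : ((c s : 'rV[R]_d) == c t) = (s == t).
  by apply/eqP/eqP => [st|->//]; rewrite -(ic s) st ic.
have sN (F : 'I_N -> R) a : (forall n, F n = a) -> \sum_n F n = a * N%:R.
  by move=> Fa; rewrite (eq_bigr (fun=> a))// sumr_const card_ord mulr_natr.
have emp1 A : (forall n, p2 n \in A) -> empirical N p2 A = 1%E.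
  by move=> h2; rewrite empiricalE (sN _ 1) ?mul1r ?mulVf ?gt_eqF// => n; rewrite h2.
pose cnt s : R := \sum_(n < N) ((y n).1 == s)%:R.
have cntE s : (\sum_(n < N) ((p1 n : 'rV[R]_d) == c s))%:R = cnt s :> R.
  by rewrite natr_sum; apply: eq_bigr => n _; rewrite /p1 c_inj.
have cnt_gt0 (n : 'I_N) : 0 < cnt (y n).1.
  rewrite /cnt (bigD1 n)//= eqxx ltr_pwDl// sumr_ge0//.
have cond1 A (n : 'I_N) : (forall n, p2 n \in A) -> emp_cond N p1 p2 (p1 n) A = 1%E.
  move=> h2; rewrite emp_condE cntE.
  under eq_bigr => n' _ do rewrite h2 mulr1 /p1 c_inj.
  by rewrite mulVf// gt_eqF.
pose f s t := (cnt s)^-1 * \sum_(n < N) ((y n).1 == s)%:R * ((y n).2 == t)%:R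
   - freq snd (mkseq y N) t.
have /choice[r hr] : forall n : 'I_N, exists r,
    W1 (emp_cond N p1 p2 (p1 n)) (empirical N p2) = r%:E /\
    `|r - kr dist B (f (y n).1)| <= 2 * h.
  move=> n.
  have [r Wr hr] := W1_approx (y n).1 mi h_ge0 ih dist_B
    (cond1 setT n (fun _ => in_setT _)) (emp1 setT (fun _ => in_setT _))
    (cond1 cube n (fun _ => mem_set (c_cube _))) (emp1 cube (fun _ => mem_set (c_cube _))).
  exists r; split => //; apply: le_trans hr; rewrite le_eqVlt; apply/orP; left; apply/eqP.
  congr (`|r - kr _ _ _|); apply/funext => t; rewrite /f empiricalE emp_condE cntE /= freqE.
  have inE' s : (c s \in i @^-1` [set t]) = (s == t).
    by apply/idP/eqP => [/set_mem/=|st]; [rewrite ic|apply/mem_set; rewrite /= ic].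
  congr (_ * _ - _ * _).
    by apply: eq_bigr => n' _; rewrite /p1 /p2 c_inj inE'.
  by apply: eq_bigr => n' _; rewrite /p2 inE'.
exists (N%:R^-1 * \sum_(n < N) r n).
  by rewrite EFinM -sumEFin; congr (_ * _)%E; apply: eq_bigr => n _; rewrite -(hr n).1.
have -> : dependence dist B (empirical_joint (mkseq y N)) =
    N%:R^-1 * \sum_(n < N) kr dist B (f (y n).1).
  have d0 s t : 0 <= dist s t by exact: eucl_ge0.
  transitivity (\sum_s N%:R^-1 * (cnt s * kr dist B (f s))).
    apply: eq_bigr => s _.
    have cnt0 : 0 <= cnt s by apply: sumr_ge0.
    have a0 : 0 <= N%:R^-1 * cnt s by rewrite mulr_ge0 ?invr_ge0.
    rewrite mulrA -(krZ d0 (ltW B_gt0) _ a0); congr (kr _ _ _); apply/funext => t.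
    rewrite marg1_empirical freqE -/(cnt s) /f mulrBr; congr (_ - _ * _).
      rewrite /empirical_joint freqE -mulrA; congr (_ * _).
      have -> : \sum_(n < N) (id (y n) == (s, t))%:R =
          \sum_(n < N) ((y n).1 == s)%:R * ((y n).2 == t)%:R :> R.
        by apply: eq_bigr => n _; rewrite -natrM mulnb; congr (_%:R); case: (y n).
      (* In a cell without samples both sides are zero. *)
      have [c0|c0] := eqVneq (cnt s) 0; last by rewrite mulVKf.
      rewrite c0 mul0r big1// => n _; case: eqP => [ns|]; last by rewrite mul0r.
      by have := cnt_gt0 n; rewrite ns c0 ltxx.
    exact: marg2_empirical.
  rewrite -mulr_sumr; congr (_ * _); under eq_bigr do rewrite mulr_suml.
  rewrite exchange_big/=; apply: eq_bigr => n _.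
  rewrite (bigD1 (y n).1)//= eqxx mul1r big1 ?addr0// => s /negbTE.
  by rewrite eq_sym => ->; rewrite mul0r.
rewrite -mulrBr -sumrB normrM [`|_^-1|]ger0_norm ?invr_ge0 ?ler0n// ler_pdivrMl//.
rewrite (le_trans (ler_norm_sum _ _ _))//.
rewrite [leRHS]mulrC -(sN (fun=> 2 * h))//; apply: ler_sum => n _.
exact: (hr n).2.
Qed.

End EmpiricalMeasure.

Lemma phiN_center {R : realType} {d N m : nat} (x : Rd R d) : @cells R d N = m.+1 ->
  phiN N x = cell_center (cell_index m x).
Proof.
by move=> cellsE; apply/rowP => j; rewrite !mxE ffunE cellsE center1E.
Qed.

(** * Discretized i.i.d. samples *)

Section IidCells.
Context {R : realType} {d : nat} {S : finType}.
Local Notation T := (Rd R d).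
Context (i : T -> S).
Hypothesis mi : forall s, measurable (i @^-1` [set s]).
Context (pi : probability (T * T)%type R) {dO : measure_display}
  {Omega : measurableType dO} (P : probability Omega R) (X : nat -> Omega -> T * T).
Hypothesis iid : iid_law P X pi.

Definition cell_pair n w := (i (X n w).1, i (X n w).2).

Let cell (p : S * S) : set (T * T) := (i @^-1` [set p.1]) `*` (i @^-1` [set p.2]).

Let mcell p : measurable (cell p).
Proof. exact: measurableX. Qed.

Let cell_pairE n p : cell_pair n @^-1` [set p] = X n @^-1` cell p.
Proof.
case: p => s t; apply/seteqP; split=> w /=; first by rewrite /cell_pair => -[<- <-].
by case=> /= ws wt; rewrite /cell_pair ws wt.
Qed.

Lemma measurable_cell_pair n p : measurable (cell_pair n @^-1` [set p]).
Proof. by rewrite cell_pairE -[X in measurable X]setTI; apply: iid.1. Qed.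

Lemma cell_pair_law n (t : nat -> S * S) :
  P (\bigcap_(j in [set j | j \in iota 0 n]) (cell_pair j @^-1` [set t j])) =
  (\prod_(j <- iota 0 n) cell_law i pi (t j))%:E.
Proof.
rewrite (big_morph EFin EFinM erefl).
transitivity (\prod_(j <- iota 0 n) P (X j @^-1` cell (t j)))%E.
  rewrite -(iid.2.2 (iota 0 n) (fun j => cell (t j)))//; last exact: iota_uniq.
  by congr (P _); apply: eq_bigcapr => j _; exact: cell_pairE.
apply: eq_bigr => j _; have mc := mcell (t j); rewrite iid.2.1//.
by apply/esym/fineK; exact: fin_num_measure.
Qed.

End IidCells.

Theorem mainTheorem12 (R : realType) (d : nat) (d_gt0 : (0 < d)%N)
  (pi : probability (Rd R d * Rd R d)%type R)
  (pi_cube : pi (cube `*` cube) = 1%E)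
  (mu nu : probability (Rd R d) R)
  (mu_marg : forall A, measurable A -> mu A = pi (A `*` setT))
  (nu_marg : forall B, measurable B -> nu B = pi (setT `*` B))
  (k : R.-pker (Rd R d) ~> (Rd R d))
  (k_dis : disintegration pi mu k)
  (k_lip : lipschitz_kernel k) :
  exists c C : R, 0 < c /\ 0 < C /\
  forall (dO : measure_display) (Omega : measurableType dO)
         (P : probability Omega R)
         (X : nat -> Omega -> (Rd R d * Rd R d)%type),
  iid_law P X pi ->
  forall (N : nat) (eps : R), (0 < N)%N -> 0 < eps ->
  (P [set w | let p1 := fun n => phiN N (X n w).1 in
              let p2 := fun n => phiN N (X n w).2 in
              ((2 * C * @rate R d N + eps)%:E <=
               `| \int[empirical N p1]_x1 W1 (emp_cond N p1 p2 x1) (empirical N p2)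
                  - \int[mu]_x1 W1 (k x1) nu |)%E]
   <= (4 * expR (- c * N%:R * eps ^+ 2))%:E)%E.
Proof.
have [L hL] := k_lip.
have dR : 0 < d%:R :> R by rewrite ltr0n.
have sd : 0 < Num.sqrt d%:R :> R by rewrite sqrtr_gt0.
have rc0 : 0 <= @rate_constant R d.
  by rewrite /rate_constant mulr_ge0 ?sqrtr_ge0// addr_ge0// mulr_ge0// sqrtr_ge0.
(* 2 C is the coefficient of the mean deviation plus that of the discretization errors: 2 h for the
   empirical side and (2 |L| + 4) h for [pi], where h <= 2 sqrt d times the rate. *)
pose C : R := (@rate_constant R d + 4 * (Num.sqrt d%:R * (3 + `|L|))) / 2.
exists (288 * d%:R)^-1, C; split; first by rewrite invr_gt0 mulr_gt0.
split.
  have L3 : 0 < 3 + `|L| by rewrite ltr_pwDl.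
  apply: divr_gt0 => //; apply: ltr_wpDl => //.
  by apply: mulr_gt0 => //; exact: mulr_gt0.
move=> dO Omega P X iid N eps N0 eps0.
have [m cellsE] : exists m, @cells R d N = m.+1.
  by exists (@cells R d N).-1; rewrite prednK// (cells_gt0 d_gt0 N0).
have M0 : 0 < m.+1%:R :> R by rewrite ltr0n.
pose S := grid (d := d) m; pose i : Rd R d -> S := cell_index m.
pose h : R := Num.sqrt d%:R * (2^-1 / m.+1%:R).
have h0 : 0 <= h by rewrite mulr_ge0 ?sqrtr_ge0// divr_ge0 ?ler0n.
have mi : forall s, measurable (i @^-1` [set s]) by exact: measurable_cell_index.
have ih : forall x, cube x -> eucl x (cell_center (i x)) <= h by exact: eucl_center_index.
have dB := @eucl_center_le R d m.
pose w := cell_law i pi; pose dist := center_dist (@cell_center R d m).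
have w_ge0 p : 0 <= w p by exact: cell_law_ge0.
have w_sum : \sum_p w p = 1 by exact: (cell_law_sum mi mu_marg).
have [I -> hI] := dependence_bias mi h0 ih sd dB pi_cube mu_marg nu_marg k_dis hL.
pose Y := cell_pair i X.
pose thr := 2 * C * @rate R d N + eps.
pose u0 : S * S := (i 0, i 0).
pose F (y : nat -> S * S) := plug_in N (@cell_center R d m) y.
(* [transfer] takes a Boolean predicate on finite sequences. The default [u0] is harmless, since
   [plug_in] reads only the first N entries. *)
pose bad (s : seq (S * S)) := `[< (thr%:E <= `|F (nth u0 s) - I%:E|)%E >].
have plug_inE w0 : (\int[empirical N (fun n => phiN N (X n w0).1)]_x1
      W1 (emp_cond N (fun n => phiN N (X n w0).1) (fun n => phiN N (X n w0).2) x1)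
        (empirical N (fun n => phiN N (X n w0).2)) =
    F (nth u0 (mkseq (fun n => Y n w0) N)))%E.
  have -> : (fun n => phiN N (X n w0).1) = (fun n => cell_center (Y n w0).1).
    by apply/funext => n; rewrite (phiN_center _ cellsE).
  have -> : (fun n => phiN N (X n w0).2) = (fun n => cell_center (Y n w0).2).
    by apply/funext => n; rewrite (phiN_center _ cellsE).
  rewrite integral_empirical; last 2 first.
  - exact: (measurable_W1_emp_cond N (@cell_index_center R d m) (fun n => Y n w0)).
  - by move=> x; exact: W1_ge0.
  rewrite -/(plug_in N (@cell_center R d m) (fun n => Y n w0)) /F.
  by apply: eq_plug_in => n nN; rewrite nth_mkseq.
set ev := [set w0 | _].
have -> : ev = [set w0 | bad (mkseq (fun n => Y n w0) N)].
  apply/seteqP; split=> w0 H; first by apply/asboolP; rewrite -plug_inE; exact: H.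
  by move/asboolP : H; rewrite -plug_inE.
have [_ ->] := transfer w_ge0 (measurable_cell_pair mi iid) (cell_pair_law mi iid) bad N.
rewrite lee_fin.
have dev := Ex_deviation_rate d_gt0 N0 cellsE w_ge0 w_sum.
have conc := deviation_concentration (fun s t => eucl_ge0 (cell_center s) (cell_center t)) sd
  (fun s t => euclC (cell_center s) (cell_center t)) w_ge0 w_sum N0 eps0 dev.
(* The one-sided McDiarmid bound is applied to an absolute value, so it holds with prefactor 1,
   below the 4 of the claim. *)
apply: (@le_trans _ _ (expR (- (N%:R * eps ^+ 2 / (288 * Num.sqrt d%:R ^+ 2))))); last first.
  rewrite sqr_sqrtr ?ler0n//.
  have -> : - (N%:R * eps ^+ 2 / (288 * d%:R)) = - (288 * d%:R)^-1 * N%:R * eps ^+ 2 by ring.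
  by rewrite ler_peMl ?expR_ge0//; lra.
apply: (le_trans _ conc); apply: le_Ex => // s sN.
have [/asboolP hbad|//] := boolP (bad s).
(* A bad sample exceeds the threshold by enough that, after both discretization errors are
   subtracted, the deviation of [dependence] is still [eps] above the bound on its mean. *)
suff dev_ge : @rate_constant R d * @rate R d N + eps <=
    deviation (fun s t => eucl (cell_center s) (cell_center t)) (Num.sqrt d%:R) w s.
  by rewrite dev_ge.
have [r Fr hr] := plug_in_dependence N0 mi (@cell_index_center R d m) (@cube_center R d m)
  h0 ih sd dB (nth u0 s).
move: hbad; rewrite /F Fr -EFinB abse_EFin lee_fin => hbad.
move: hr; rewrite -[X in mkseq _ X]sN mkseq_nth => hr.
have hM : h <= Num.sqrt d%:R * (2 * @rate R d N).
  rewrite /h ler_wpM2l ?sqrtr_ge0//.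
  have := invr_cells_le d_gt0 N0 (R := R); rewrite cellsE.
  have := powR_rate_le d_gt0 N0 (R := R).
  by move: (_ `^ _) (m.+1%:R^-1) => x y; lra.
have hML : (6 + 2 * `|L|) * h <= (6 + 2 * `|L|) * (Num.sqrt d%:R * (2 * @rate R d N)).
  by rewrite ler_wpM2l// addr_ge0// mulr_ge0.
pose a := dependence dist (Num.sqrt d%:R) (empirical_joint s).
pose b := dependence dist (Num.sqrt d%:R) (fun s t => w (s, t)).
have {}hr : `|r - a| <= 2 * h by exact: hr.
have {}hI : `|b - I| <= (2 * `|L| + 4) * h by rewrite distrC; exact: hI.
have -> : deviation (fun s t => eucl (cell_center s) (cell_center t))
  (Num.sqrt d%:R) w s = `|a - b|.
  by [].
have t1 := ler_distD a r I; have t2 := ler_distD b a I.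
have thrE : thr = @rate_constant R d * @rate R d N
    + (6 + 2 * `|L|) * (Num.sqrt d%:R * (2 * @rate R d N)) + eps.
  by rewrite /thr /C; field.
have hsum : 2 * h + (2 * `|L| + 4) * h = (6 + 2 * `|L|) * h by ring.
have := le_trans hbad (le_trans t1 (lerD hr (le_trans t2 (lerD (lexx _) hI)))).
rewrite thrE addrCA hsum addrAC => dev_bound.
by have := le_trans dev_bound (lerD (lexx _) hML); rewrite lerD2r.
Qed.
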